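(* Let $N\in\mathbb N$ and let $M$ be a finitely generated, eventually vanishing $\mathbb Z^N$-persistence module. Then: \begin{enumerate} \item Any free resolution of $M$ has length at least $N$, with equality for minimal free resolutions. \item If $G$ is a free resolution of $M$ with length $N$, then $G[N]^\dagger$, viewed as a chain complex, is a free resolution of $M^*$. Likewise, if $G$ is a minimal free resolution of $M$ with length $N$, then $G[N]^\dagger$, viewed as a chain complex, is a minimal free resolution of $M^*$. \end{enumerate}
   Context: Fix a field $\mathbb F$ and $N\in\mathbb N$; $\mathbb Z^N$ carries the product partial order. A $\mathbb Z^N$-persistence module is a functor $M$ from the poset $\mathbb Z^N$ to finite-dimensional $\mathbb F$-vector spaces, with components $M_z$ and structure maps $M_{z'z}\colon M_z\to M_{z'}$ for $z\le z'$; morphisms are natural transformations, and $\operatorname{Hom}(L,M)$ is the vector space of morphisms. $M$ is finitely generated if there are finitely many $s_i\in M_{g_i}$ such that for each $z$ the images $M_{z,g_i}(s_i)$ with $g_i\le z$ span $M_z$. $M$ eventually vanishes if its support $\{z\in\mathbb Z^N: M_z\ne 0\}$ is bounded above. The shift $M\langle z\rangle$ has components $M\langle z\rangle_w=M_{z+w}$. For $z\in\mathbb Z^N$, $F(z)$ is the persistence module with $F(z)_v=\mathbb F$ if $z\le v$ and $0$ otherwise, with identities between nonzero components. A persistence module is free if it is isomorphic to a direct sum of modules $F(z)$, $z\in\mathbb Z^N$; it has finite rank if the sum can be taken finite. Pointwise dual: $(M^* )_z=\operatorname{Hom}_{\mathbb F}(M_{-z},\mathbb F)$ with dualized structure maps.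 Global dual: with $\mathbf 1=(1,\dotsc,1)$, $(M^\dagger)_z=\operatorname{Hom}(M,F(\mathbf 1)\langle z\rangle)=\operatorname{Hom}(M,F(\mathbf 1-z))$ with induced structure maps; in particular $F(z)^\dagger\cong F(\mathbf 1-z)$. Both are contravariant and are applied degreewise to complexes. A free resolution of $M$ is a chain complex $G$ of free modules concentrated in nonnegative degrees together with a morphism $\varepsilon\colon G_0\to M$ such that $\dotsb\to G_1\to G_0\xrightarrow{\varepsilon} M\to 0$ is exact. Its length is the maximal $d$ with $G_d\ne0$ ($\infty$ if there is no maximum). A homological ball is a chain complex $\dotsb\to0\to F(z)\xrightarrow{\mathrm{id}}F(z)\to0\to\dotsb$, for some $z\in\mathbb Z^N$, concentrated in two consecutive degrees. A chain complex of finite rank free modules is minimal if it has no homological ball as a direct summand; a free resolution is minimal if it is minimal as a chain complex. $G[N]$ is the shifted complex $G[N]_d=G_{d+N}$; $G[N]^\dagger$ is the cochain complex with $(G[N]^\dagger)^d=(G_{d+N})^\dagger$, viewed as a chain complex via $D_d=D^{-d}$, so that its component in homological degree $d$ is $(G_{N-d})^\dagger$.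
   Formalization: Part 1 is stated for nonzero M (it fails for M = 0), and the first claim of part 2 assumes that all components of G[N]^† are pointwise finite-dimensional, which can fail for resolutions of infinite rank and is automatic for finite rank. *)

(* Defs.v *)
From HB Require Import structures.
From mathcomp Require Import all_boot all_order all_algebra.
From mathcomp Require Import boolp classical_sets cardinality.
From mathcomp Require Import zify.

Set Implicit Arguments.
Unset Strict Implicit.
Unset Printing Implicit Defensive.

Import Order.TTheory GRing.Theory Num.Theory.
Local Open Scope ring_scope.

Definition nonzero (K : fieldType) (V : lmodType K) : Prop :=
  exists x : V, x != 0.

Definition in_span (K : fieldType) (V : lmodType K) (A : set V) (x : V) : Prop :=
  exists (n : nat) (v : 'I_n -> V) (c : 'I_n -> K),
    (forall i, A (v i)) /\ x = \sum_i c i *: v i.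

Definition findim (K : fieldType) (V : lmodType K) : Prop :=
  exists (n : nat) (b : 'I_n -> V), forall x, in_span (range b) x.

(** The vector space of linear maps between arbitrary vector spaces; MathComp's
    ['Hom(V, W)] is restricted to [vectType]. *)
Definition vhom (K : fieldType) (V W : lmodType K) : Type := {linear V -> W}.

Section VHom.
Context (K : fieldType) (V W : lmodType K).

Definition vhom_linear (f : vhom V W) : {linear V -> W} := f.
Local Coercion vhom_linear : vhom >-> GRing.Linear.type.

HB.instance Definition _ := gen_eqMixin (vhom V W).
HB.instance Definition _ := gen_choiceMixin (vhom V W).

Lemma linearP_eq (f g : {linear V -> W}) : f =1 g -> f = g.
Proof.
case: f g => [f [[f1] [f2]]] [g [[g1] [g2]]] /= fg.
have {fg} E : f = g by apply: funext.
subst g; by rewrite (Prop_irrelevance f1 g1) (Prop_irrelevance f2 g2).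
Qed.

Definition vhom0 : vhom V W := (\0 : {linear V -> W}).
Definition vhomD (f g : vhom V W) : vhom V W := (f \+ g : {linear V -> W}).
Definition vhomN (f : vhom V W) : vhom V W := (\- f : {linear V -> W}).
Definition vhomZ (a : K) (f : vhom V W) : vhom V W := (a \*: f : {linear V -> W}).

Fact vhomDA : associative vhomD.
Proof. by move=> f g h; apply: linearP_eq => x /=; rewrite addrA. Qed.
Fact vhomDC : commutative vhomD.
Proof. by move=> f g; apply: linearP_eq => x /=; rewrite addrC. Qed.
Fact vhom0D : left_id vhom0 vhomD.
Proof. by move=> f; apply: linearP_eq => x /=; rewrite add0r. Qed.
Fact vhomND : left_inverse vhom0 vhomN vhomD.
Proof. by move=> f; apply: linearP_eq => x /=; rewrite addNr. Qed.
HB.instance Definition _ :=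
  GRing.isZmodule.Build (vhom V W) vhomDA vhomDC vhom0D vhomND.

Fact vhomZA a b f : vhomZ a (vhomZ b f) = vhomZ (a * b) f.
Proof. by apply: linearP_eq => x /=; rewrite scalerA. Qed.
Fact vhom1Z : left_id 1 vhomZ.
Proof. by move=> f; apply: linearP_eq => x /=; rewrite scale1r. Qed.
Fact vhomZDr : right_distributive vhomZ +%R.
Proof. by move=> a f g; apply: linearP_eq => x /=; rewrite scalerDr. Qed.
Fact vhomZDl f : {morph vhomZ^~ f : a b / a + b}.
Proof. by move=> a b; apply: linearP_eq => x /=; rewrite scalerDl. Qed.
HB.instance Definition _ :=
  GRing.Zmodule_isLmodule.Build K (vhom V W) vhomZA vhom1Z vhomZDr vhomZDl.

End VHom.
Coercion vhom_linear : vhom >-> GRing.Linear.type.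

Definition vunit (K : fieldType) (b : bool) : lmodType K :=
  if b then (K^o : lmodType K) else ('rV[K]_0 : lmodType K).

Definition vunit_map (K : fieldType) (b c : bool) :
    {linear vunit K b -> vunit K c} :=
  match b, c with
  | true, true => idfun : {linear vunit K true -> vunit K true}
  | _, _ => \0 : {linear _ -> _}
  end.

Notation grade N := 'rV[int]_N.

Definition gle (N : nat) (z w : grade N) : bool :=
  [forall i, z ord0 i <= w ord0 i].

Definition gone (N : nat) : grade N := const_mx 1.

Section Order.
Context (N : nat).
Implicit Types x y z : grade N.
Fact gle_refl z : gle z z.
Proof. by apply/forallP. Qed.
Fact gle_trans x y z : gle x y -> gle y z -> gle x z.
Proof.
move=> /forallP xy /forallP yz; apply/forallP => i; exact: le_trans (yz i).
Qed.
Fact gle_addl x y z : gle y z -> gle (x + y) (x + z).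
Proof. by move=> /forallP yz; apply/forallP => i; rewrite !mxE lerD2l. Qed.
Fact gle_addr x y z : gle y z -> gle (y + x) (z + x).
Proof. by move=> /forallP yz; apply/forallP => i; rewrite !mxE lerD2r. Qed.
Fact gle_opp y z : gle y z -> gle (- z) (- y).
Proof. by move=> /forallP yz; apply/forallP => i; rewrite !mxE lerN2. Qed.
End Order.

(** Functors from the poset Z^N to all [K]-vector spaces; persistence modules are
    the pointwise finite-dimensional ones ([persistence_module]).  The larger
    category is the natural home of the global dual: [Hom(M, F(1)<z>)] need not be
    finite-dimensional, not even for a pointwise finite-dimensional free [M] of
    infinite rank, such as the sum of all [F(k)], [k >= 0], for N = 1. *)
Record functor (K : fieldType) (N : nat) := Functor {
  obj :> grade N -> lmodType K;
  smap : forall z w, gle z w -> {linear obj z -> obj w};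
  smap_id : forall z (h : gle z z) x, smap h x = x;
  smap_comp : forall u v w (h : gle u v) (h' : gle v w) (h'' : gle u w) x,
    smap h' (smap h x) = smap h'' x }.
Arguments smap {K N} M {z w} h : rename.

Definition persistence_module (K : fieldType) (N : nat) (M : functor K N) : Prop :=
  forall z, findim (M z).

Definition nonzero_functor (K : fieldType) (N : nat) (M : functor K N) : Prop :=
  exists z, nonzero (M z).

Definition finitely_generated (K : fieldType) (N : nat) (M : functor K N) : Prop :=
  exists (n : nat) (g : 'I_n -> grade N) (s : forall i, M (g i)),
    forall z (x : M z),
      in_span [set y | exists (i : 'I_n) (h : gle (g i) z), y = smap M h (s i)] x.

Definition eventually_vanishes (K : fieldType) (N : nat) (M : functor K N) : Prop :=
  exists u : grade N, forall z, nonzero (M z) -> gle z u.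

Record mor (K : fieldType) (N : nat) (L M : functor K N) := Mor {
  app :> forall z, {linear L z -> M z};
  app_natural : forall z w (h : gle z w) x,
    app w (smap L h x) = smap M h (app z x) }.

Section MorSpace.
Context (K : fieldType) (N : nat) (L M : functor K N).
Implicit Types f g : mor L M.

HB.instance Definition _ := gen_eqMixin (mor L M).
HB.instance Definition _ := gen_choiceMixin (mor L M).

Lemma morP f g : (forall z x, f z x = g z x) -> f = g.
Proof.
case: f g => [f nf] [g ng] /= fg.
have E : f = g.
  by apply: functional_extensionality_dep => z; apply: linearP_eq => x; apply: fg.
by subst g; rewrite (Prop_irrelevance nf ng).
Qed.

Fact mor0_natural z w (h : gle z w) (x : L z) :
  (\0 : {linear L w -> M w}) (smap L h x) = smap M h ((\0 : {linear L z -> M z}) x).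
Proof. by rewrite /= linear0. Qed.
Definition mor0 : mor L M := Mor mor0_natural.

Fact morD_natural f g z w (h : gle z w) (x : L z) :
  (f w \+ g w) (smap L h x) = smap M h ((f z \+ g z) x).
Proof. by rewrite /= linearD !app_natural. Qed.
Definition morD f g : mor L M :=
  @Mor _ _ L M (fun z => f z \+ g z : {linear L z -> M z}) (morD_natural f g).

Fact morN_natural f z w (h : gle z w) (x : L z) :
  (\- f w) (smap L h x) = smap M h ((\- f z) x).
Proof. by rewrite /= linearN app_natural. Qed.
Definition morN f : mor L M :=
  @Mor _ _ L M (fun z => \- f z : {linear L z -> M z}) (morN_natural f).

Fact morZ_natural a f z w (h : gle z w) (x : L z) :
  (a \*: f w) (smap L h x) = smap M h ((a \*: f z) x).
Proof. by rewrite /= linearZ app_natural. Qed.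
Definition morZ a f : mor L M :=
  @Mor _ _ L M (fun z => a \*: f z : {linear L z -> M z}) (morZ_natural a f).

Fact morDA : associative morD.
Proof. by move=> f g h; apply: morP => z x /=; rewrite addrA. Qed.
Fact morDC : commutative morD.
Proof. by move=> f g; apply: morP => z x /=; rewrite addrC. Qed.
Fact mor0D : left_id mor0 morD.
Proof. by move=> f; apply: morP => z x /=; rewrite add0r. Qed.
Fact morND : left_inverse mor0 morN morD.
Proof. by move=> f; apply: morP => z x /=; rewrite addNr. Qed.
HB.instance Definition _ :=
  GRing.isZmodule.Build (mor L M) morDA morDC mor0D morND.

Fact morZA a b f : morZ a (morZ b f) = morZ (a * b) f.
Proof. by apply: morP => z x /=; rewrite scalerA. Qed.
Fact mor1Z : left_id 1 morZ.
Proof. by move=> f; apply: morP => z x /=; rewrite scale1r. Qed.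
Fact morZDr : right_distributive morZ +%R.
Proof. by move=> a f g; apply: morP => z x /=; rewrite scalerDr. Qed.
Fact morZDl f : {morph morZ^~ f : a b / a + b}.
Proof. by move=> a b; apply: morP => z x /=; rewrite scalerDl. Qed.
HB.instance Definition _ :=
  GRing.Zmodule_isLmodule.Build K (mor L M) morZA mor1Z morZDr morZDl.

End MorSpace.

Section Category.
Context (K : fieldType) (N : nat).

Definition hid (M : functor K N) : mor M M :=
  @Mor _ _ M M (fun z => idfun : {linear M z -> M z}) (fun _ _ _ _ => erefl).

Fact hcomp_natural (L M P : functor K N) (g : mor M P) (f : mor L M)
    z w (h : gle z w) x :
  (g w \o f w) (smap L h x) = smap P h ((g z \o f z) x).
Proof. by rewrite /= !app_natural. Qed.
Definition hcomp (L M P : functor K N) (g : mor M P) (f : mor L M) : mor L P :=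
  @Mor _ _ L P (fun z => g z \o f z : {linear L z -> P z}) (hcomp_natural g f).

Definition isomorphic (L M : functor K N) : Prop :=
  exists (f : mor L M) (g : mor M L), hcomp g f = hid L /\ hcomp f g = hid M.

End Category.

Section Constructions.
Context (K : fieldType) (N : nat).

Definition zero_functor : functor K N :=
  @Functor K N (fun _ => 'rV[K]_0 : lmodType K)
    (fun _ _ _ => idfun : {linear 'rV[K]_0 -> 'rV[K]_0})
    (fun _ _ _ => erefl) (fun _ _ _ _ _ _ _ => erefl).

Definition shift (M : functor K N) (z : grade N) : functor K N :=
  @Functor K N (fun w => M (z + w)) (fun v w h => smap M (gle_addl z h))
    (fun w h => @smap_id _ _ M (z + w) (gle_addl z h))
    (fun u v w h h' h'' => smap_comp (gle_addl z h) (gle_addl z h') (gle_addl z h'')).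

Fact shift_map_natural (M : functor K N) (z w : grade N) (h : gle z w)
    u v (h' : gle u v) x :
  smap M (gle_addr v h) (smap (shift M z) h' x) =
  smap (shift M w) h' (smap M (gle_addr u h) x).
Proof.
have h2 : gle (z + u) (w + v) by apply: gle_trans (gle_addr v h); apply: gle_addl.
by rewrite /= !(smap_comp _ _ h2).
Qed.
Definition shift_map (M : functor K N) (z w : grade N) (h : gle z w) :
    mor (shift M z) (shift M w) :=
  @Mor K N (shift M z) (shift M w) (fun v => smap M (gle_addr v h))
    (shift_map_natural h).

Definition pair_map (U V U' V' : lmodType K)
    (f : {linear U -> U'}) (g : {linear V -> V'}) (x : U * V) : U' * V' :=
  (f x.1, g x.2).
Fact pair_map_linear U V U' V' f g : linear (@pair_map U V U' V' f g).
Proof. by move=> a x y; rewrite /pair_map /= !linearP. Qed.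
HB.instance Definition _ (U V U' V' : lmodType K)
    (f : {linear U -> U'}) (g : {linear V -> V'}) :=
  GRing.isLinear.Build K (U * V)%type (U' * V')%type *:%R
    (@pair_map U V U' V' f g) (pair_map_linear f g).

Section Biprod.
Context (L M : functor K N).
Let smap2 z w (h : gle z w) : {linear (L z * M z)%type -> (L w * M w)%type} :=
  pair_map (smap L h) (smap M h).
Fact biprod_id z (h : gle z z) x : smap2 h x = x.
Proof. by case: x => a b; rewrite /= /pair_map !smap_id. Qed.
Fact biprod_comp u v w (h : gle u v) (h' : gle v w) (h'' : gle u w) x :
  smap2 h' (smap2 h x) = smap2 h'' x.
Proof. by rewrite /= /pair_map !(smap_comp _ _ h''). Qed.
Definition biprod : functor K N :=
  @Functor K N (fun z => (L z * M z)%type) smap2 biprod_id biprod_comp.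
End Biprod.

Fact biprod_map_natural (L M L' M' : functor K N) (f : mor L L') (g : mor M M')
    z w (h : gle z w) x :
  pair_map (f w) (g w) (smap (biprod L M) h x) =
  smap (biprod L' M') h (pair_map (f z) (g z) x).
Proof. by rewrite /= /pair_map /= !app_natural. Qed.
Definition biprod_map (L M L' M' : functor K N) (f : mor L L') (g : mor M M') :
    mor (biprod L M) (biprod L' M') :=
  @Mor K N (biprod L M) (biprod L' M')
    (fun z => pair_map (f z) (g z) : {linear (L z * M z)%type -> (L' z * M' z)%type})
    (biprod_map_natural f g).

End Constructions.

Record dsum (K : fieldType) (I : Type) (V : I -> lmodType K) := DSum {
  dval :> forall i, V i;
  dval_finite : finite_set [set i | dval i != 0] }.

Section DirectSumSpace.
Context (K : fieldType) (I : Type) (V : I -> lmodType K).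
Local Notation dsum := (dsum V).
Implicit Types x y : dsum.

HB.instance Definition _ := gen_eqMixin dsum.
HB.instance Definition _ := gen_choiceMixin dsum.

Lemma dsumP x y : (forall i, x i = y i) -> x = y.
Proof.
case: x y => [x fx] [y fy] /= xy.
have E : x = y by apply: functional_extensionality_dep.
by subst y; rewrite (Prop_irrelevance fx fy).
Qed.

Fact dsum0_finite : finite_set [set i | (0 : V i) != 0].
Proof.
by apply: (@sub_finite_set _ _ set0) (finite_set0 _) => i /=; rewrite eqxx.
Qed.
Definition dsum0 : dsum := DSum dsum0_finite.

Fact dsumD_finite x y : finite_set [set i | x i + y i != 0].
Proof.
apply: (@sub_finite_set _ _ ([set i | x i != 0] `|` [set i | y i != 0])).
  move=> i /=; have [->|] := eqVneq (x i) 0; last by left.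
  by rewrite add0r; right.
by rewrite finite_setU; split; apply: dval_finite.
Qed.
Definition dsumD x y : dsum := DSum (dsumD_finite x y).

Fact dsumN_finite x : finite_set [set i | - x i != 0].
Proof.
by apply: sub_finite_set (dval_finite x) => i /=; rewrite oppr_eq0.
Qed.
Definition dsumN x : dsum := DSum (dsumN_finite x).

Fact dsumZ_finite a x : finite_set [set i | a *: x i != 0].
Proof.
apply: sub_finite_set (dval_finite x) => i /=.
by apply: contra => /eqP ->; rewrite scaler0.
Qed.
Definition dsumZ a x : dsum := DSum (dsumZ_finite a x).

Fact dsumDA : associative dsumD.
Proof. by move=> x y z; apply: dsumP => i /=; rewrite addrA. Qed.
Fact dsumDC : commutative dsumD.
Proof. by move=> x y; apply: dsumP => i /=; rewrite addrC. Qed.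
Fact dsum0D : left_id dsum0 dsumD.
Proof. by move=> x; apply: dsumP => i /=; rewrite add0r. Qed.
Fact dsumND : left_inverse dsum0 dsumN dsumD.
Proof. by move=> x; apply: dsumP => i /=; rewrite addNr. Qed.
HB.instance Definition _ := GRing.isZmodule.Build dsum dsumDA dsumDC dsum0D dsumND.

Fact dsumZA a b x : dsumZ a (dsumZ b x) = dsumZ (a * b) x.
Proof. by apply: dsumP => i /=; rewrite scalerA. Qed.
Fact dsum1Z : left_id 1 dsumZ.
Proof. by move=> x; apply: dsumP => i /=; rewrite scale1r. Qed.
Fact dsumZDr : right_distributive dsumZ +%R.
Proof. by move=> a x y; apply: dsumP => i /=; rewrite scalerDr. Qed.
Fact dsumZDl x : {morph dsumZ^~ x : a b / a + b}.
Proof. by move=> a b; apply: dsumP => i /=; rewrite scalerDl. Qed.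
HB.instance Definition _ :=
  GRing.Zmodule_isLmodule.Build K dsum dsumZA dsum1Z dsumZDr dsumZDl.

End DirectSumSpace.

Section DirectSumMap.
Context (K : fieldType) (I : Type) (V W : I -> lmodType K).
Context (f : forall i, {linear V i -> W i}).

Fact dsum_map_finite (x : dsum V) : finite_set [set i | f i (x i) != 0].
Proof.
apply: sub_finite_set (dval_finite x) => i /=.
by apply: contra => /eqP ->; rewrite linear0.
Qed.
Definition dsum_map (x : dsum V) : dsum W := DSum (dsum_map_finite x).
Fact dsum_map_linear : linear dsum_map.
Proof. by move=> a x y; apply: dsumP => i /=; rewrite linearP. Qed.
HB.instance Definition _ :=
  GRing.isLinear.Build K (dsum V) (dsum W) *:%R dsum_map dsum_map_linear.
End DirectSumMap.

Section DirectSum.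
Context (K : fieldType) (N : nat) (I : Type) (M : I -> functor K N).
Let smapD z w (h : gle z w) :
    {linear dsum (fun i => M i z) -> dsum (fun i => M i w)} :=
  dsum_map (fun i => smap (M i) h).
Fact direct_sum_id z (h : gle z z) x : smapD h x = x.
Proof. by apply: dsumP => i /=; rewrite smap_id. Qed.
Fact direct_sum_comp u v w (h : gle u v) (h' : gle v w) (h'' : gle u w) x :
  smapD h' (smapD h x) = smapD h'' x.
Proof. by apply: dsumP => i /=; rewrite (smap_comp _ _ h''). Qed.
Definition direct_sum : functor K N :=
  @Functor K N (fun z => dsum (fun i => M i z)) smapD
    direct_sum_id direct_sum_comp.
End DirectSum.

Section Free.
Context (K : fieldType) (N : nat).

Fact free1_id (z v : grade N) (h : gle v v) (x : vunit K (gle z v)) :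
  vunit_map K (gle z v) (gle z v) x = x.
Proof. by case: (gle z v) x => //= x; rewrite [RHS]thinmx0. Qed.
Fact free1_comp (z u v w : grade N) (h : gle u v) (h' : gle v w) (h'' : gle u w)
    (x : vunit K (gle z u)) :
  vunit_map K (gle z v) (gle z w) (vunit_map K (gle z u) (gle z v) x) =
  vunit_map K (gle z u) (gle z w) x.
Proof.
case zu : (gle z u) x => x; last by rewrite /= linear0.
by rewrite (gle_trans zu h) (gle_trans zu h'').
Qed.
Definition free1 (z : grade N) : functor K N :=
  @Functor K N (fun v => vunit K (gle z v))
    (fun v w _ => vunit_map K (gle z v) (gle z w))
    (@free1_id z) (@free1_comp z).

Definition free_module (M : functor K N) : Prop :=
  exists (I : Type) (g : I -> grade N),
    isomorphic M (direct_sum (fun i => free1 (g i))).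

Definition finite_rank_free (M : functor K N) : Prop :=
  exists (n : nat) (g : 'I_n -> grade N),
    isomorphic M (direct_sum (fun i => free1 (g i))).

End Free.

Section PointwiseDual.
Context (K : fieldType) (N : nat).

Definition precomp (U V W : lmodType K) (f : {linear U -> V}) (g : vhom V W) :
  vhom U W := (g \o f : {linear U -> W}).
Fact precomp_linear U V W f : linear (@precomp U V W f).
Proof. by move=> a g h; apply: linearP_eq. Qed.
HB.instance Definition _ (U V W : lmodType K) (f : {linear U -> V}) :=
  GRing.isLinear.Build K (vhom V W) (vhom U W) *:%R (@precomp U V W f)
    (precomp_linear f).

Context (M : functor K N).
Let smapS z w (h : gle z w) : {linear vhom (M (- z)) K^o -> vhom (M (- w)) K^o} :=
  precomp (smap M (gle_opp h)).
Fact pdual_id z (h : gle z z) f : smapS h f = f.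
Proof. by apply: linearP_eq => x /=; rewrite smap_id. Qed.
Fact pdual_comp u v w (h : gle u v) (h' : gle v w) (h'' : gle u w) f :
  smapS h' (smapS h f) = smapS h'' f.
Proof. by apply: linearP_eq => x /=; rewrite (smap_comp _ _ (gle_opp h'')). Qed.
Definition pointwise_dual : functor K N :=
  @Functor K N (fun z => vhom (M (- z)) K^o) smapS pdual_id pdual_comp.
End PointwiseDual.

Section GlobalDual.
Context (K : fieldType) (N : nat).
Implicit Types L M P : functor K N.

Fact hcomp_linearr L M P (g : mor M P) : linear (@hcomp K N L M P g).
Proof. by move=> a f f'; apply: morP => z x /=; rewrite linearP. Qed.
HB.instance Definition _ L M P (g : mor M P) :=
  GRing.isLinear.Build K (mor L M) (mor L P) *:%R (@hcomp K N L M P g)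
    (hcomp_linearr g).

Definition hprecomp L M P (f : mor L M) (g : mor M P) : mor L P := hcomp g f.
Fact hprecomp_linear L M P (f : mor L M) : linear (@hprecomp L M P f).
Proof. by move=> a g g'; apply: morP => z x. Qed.
HB.instance Definition _ L M P (f : mor L M) :=
  GRing.isLinear.Build K (mor M P) (mor L P) *:%R (@hprecomp L M P f)
    (hprecomp_linear f).

Section Def.
Context (M : functor K N).
Let F1 := free1 K (gone N).
Let smapG z w (h : gle z w) : {linear mor M (shift F1 z) -> mor M (shift F1 w)} :=
  hcomp (shift_map F1 h).
Fact gdual_id z (h : gle z z) f : smapG h f = f.
Proof. by apply: morP => v x; exact: (@smap_id _ _ F1). Qed.
Fact gdual_comp u v w (h : gle u v) (h' : gle v w) (h'' : gle u w) f :
  smapG h' (smapG h f) = smapG h'' f.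
Proof. by apply: morP => y x; exact: (@smap_comp _ _ F1). Qed.
Definition global_dual : functor K N :=
  @Functor K N (fun z => mor M (shift (free1 K (gone N)) z)) smapG
    gdual_id gdual_comp.
End Def.

Fact gdual_map_natural L M (f : mor L M) z w (h : gle z w) g :
  hprecomp f (smap (global_dual M) h g) = smap (global_dual L) h (hprecomp f g).
Proof. by apply: morP. Qed.
Definition global_dual_map L M (f : mor L M) : mor (global_dual M) (global_dual L) :=
  @Mor K N (global_dual M) (global_dual L)
    (fun z => @hprecomp L M (shift (free1 K (gone N)) z) f
       : {linear global_dual M z -> global_dual L z})
    (gdual_map_natural f).

End GlobalDual.

(** The differential is a family indexed by all pairs of consecutive degrees, so
    that reindexing a complex needs no transport along equations in [int]. *)
Record complex (K : fieldType) (N : nat) := Complex {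
  term :> int -> functor K N;
  bd : forall i j, i = j + 1 -> mor (term i) (term j);
  bd_bd : forall i j k (hij : i = j + 1) (hjk : j = k + 1) z x,
    bd hjk z (bd hij z x) = 0 }.
Arguments bd {K N} C {i j} h : rename.

Section Complexes.
Context (K : fieldType) (N : nat).
Implicit Types (C D : complex K N) (M : functor K N).

Definition complex_iso C D : Prop :=
  exists (f : forall i, mor (C i) (D i)) (g : forall i, mor (D i) (C i)),
    (forall i j (h : i = j + 1), hcomp (f j) (bd C h) = hcomp (bd D h) (f i)) /\
    (forall i, hcomp (g i) (f i) = hid (C i) /\ hcomp (f i) (g i) = hid (D i)).

Fact complex_sum_bd C D i j k (hij : i = j + 1) (hjk : j = k + 1) z x :
  biprod_map (bd C hjk) (bd D hjk) z (biprod_map (bd C hij) (bd D hij) z x) = 0.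
Proof. by rewrite /= /pair_map /= !bd_bd. Qed.
Definition complex_sum C D : complex K N :=
  @Complex K N (fun i => biprod (C i) (D i))
    (fun i j h => biprod_map (bd C h) (bd D h)) (@complex_sum_bd C D).

Definition direct_summand C D : Prop :=
  exists E, complex_iso D (complex_sum C E).

(** [C[n]] takes over the differentials of [C] without a sign. *)
Fact cshift_degree (n i j : int) : i = j + 1 -> i + n = j + n + 1.
Proof. by move=> ->; rewrite addrAC. Qed.
Definition cshift C (n : int) : complex K N :=
  @Complex K N (fun i => C (i + n)) (fun i j h => bd C (cshift_degree n h))
    (fun i j k h h' => bd_bd (cshift_degree n h) (cshift_degree n h')).

(** The cochain complex of global duals, viewed as a chain complex: the component
    [global_dual (C d)] of cohomological degree [d] sits in homological degree
    [- d]. *)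
Fact cdual_degree (i j : int) : i = j + 1 -> - j = - i + 1.
Proof. by move=> ->; rewrite opprD subrK. Qed.
Fact cdual_bd C i j k (hij : i = j + 1) (hjk : j = k + 1) z x :
  global_dual_map (bd C (cdual_degree hjk)) z
    (global_dual_map (bd C (cdual_degree hij)) z x) = 0.
Proof. by apply: morP => v y /=; rewrite bd_bd linear0. Qed.
Definition cdual C : complex K N :=
  @Complex K N (fun i => global_dual (C (- i)))
    (fun i j h => global_dual_map (bd C (cdual_degree h))) (@cdual_bd C).

(** The ball sits in degrees [n + 1] and [n]; a differential between two consecutive
    degrees is the identity if both are occupied, and zero otherwise. *)
Definition fzero_or (b : bool) (z : grade N) : functor K N :=
  if b then free1 K z else zero_functor K N.
Definition fzero_or_map (b c : bool) (z : grade N) :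
    mor (fzero_or b z) (fzero_or c z) :=
  match b, c with
  | true, true => hid (free1 K z)
  | _, _ => mor0 _ _
  end.
Definition in_ball (n i : int) : bool := (i == n + 1) || (i == n).
Fact ball_bd (z : grade N) (n : int) i j k (hij : i = j + 1) (hjk : j = k + 1) v x :
  fzero_or_map (in_ball n j) (in_ball n k) z v
    (fzero_or_map (in_ball n i) (in_ball n j) z v x) = 0.
Proof.
have : ~~ [&& in_ball n i, in_ball n j & in_ball n k].
  by rewrite /in_ball hij hjk; lia.
by move: x; case: (in_ball n i); case: (in_ball n j); case: (in_ball n k).
Qed.
Definition ball (z : grade N) (n : int) : complex K N :=
  @Complex K N (fun i => fzero_or (in_ball n i) z)
    (fun i j _ => fzero_or_map (in_ball n i) (in_ball n j) z) (@ball_bd z n).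

Definition free_resolution C M : Prop :=
  [/\ forall i, persistence_module (C i) /\ free_module (C i),
      forall i, i < 0 -> ~ nonzero_functor (C i) &
      exists eps : mor (C 0) M,
        [/\ forall z (x : M z), exists y, eps z y = x,
            forall z (x : C 0 z), eps z x = 0 <-> exists y, bd C (erefl : 1 = 0 + 1 :> int) z y = x &
            forall i j k (hij : i = j + 1) (hjk : j = k + 1) z (x : C j z),
              0 < j -> (bd C hjk z x = 0 <-> exists y, bd C hij z y = x)]].

Definition minimal_complex C : Prop :=
  (forall i, finite_rank_free (C i)) /\
  ~ exists z n, direct_summand (ball z n) C.

Definition minimal_free_resolution C M : Prop :=
  free_resolution C M /\ minimal_complex C.

Definition is_max_degree C (d : nat) : Prop :=
  nonzero_functor (C d) /\ forall e : nat, nonzero_functor (C e) -> (e <= d)%N.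

(** [None] stands for infinity; it is also the value at the zero complex. *)
Definition clength C : option nat :=
  if pselect (exists d, is_max_degree C d) is left h then Some (sval (cid h))
  else None.

Definition length_at_least (n : nat) (l : option nat) : Prop :=
  if l is Some d then (n <= d)%N else True.

End Complexes.

(* Main.v *)
Require Import Defs.
From HB Require Import structures.
From mathcomp Require Import all_boot all_order all_algebra finmap.
From mathcomp Require Import boolp classical_sets cardinality.
From mathcomp Require Import zify.

Set Implicit Arguments.
Unset Strict Implicit.
Unset Printing Implicit Defensive.

Import Order.TTheory GRing.Theory Num.Theory.
Local Open Scope ring_scope.

(** Write [F(w)] for the free module at [w].  Everything follows from the cohomology
    of the cochain complexes [Hom(G, F(w))] of a free resolution [G] of [M]: it
    vanishes outside degree [N], and in degree [N] it is the dual of the space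
    [M_(w-1)], naturally in [w].

    To see this, interpolate between the cofree module of the orthant [v <= w-1] and
    the free module of the orthant [v >= w] by switching one coordinate at a time.
    The union of two consecutive orthants gives a short exact sequence whose middle
    term is unrestricted in the [k]-th coordinate ([hinge_short_exact]).
    Translation along that coordinate is invertible on the middle term, whereas a
    large translation is zero on [M], because the support of [M] lies in a box, and
    hence null-homotopic on [G] ([translate_homotopy]).  So the middle term has no
    cohomology ([hinge_exact]), and the connecting homomorphisms are isomorphisms
    that raise the degree by one.  For the cofree module the cohomology is the dual
    of [M_(w-1)], in degree zero, since dualizing vector spaces is exact.  After [N]
    steps one arrives at the free module ([orthant_exact], [links_function]).

    If [M] is nonzero, then so is the cohomology in degree [N] for some [w], hence so
    is [G_N], and the length is at least [N].  If the length is [N], then the dual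
    complex, whose terms are the modules [Hom(G_d, F(1-z))], is exact except in
    degree zero, where its homology is the pointwise dual of [M]
    ([dual_resolution]).

    Minimality is used in the following form: the differential vanishes after every
    map to a simple module ([radical_differential]).  If it does not, a lift of such
    a map along the projection of [F(w)] to the simple module splits off a ball
    ([minimal_radical]); the converse is immediate ([radical_minimal]).  In this form
    minimality passes to the dual ([dual_radical]), and it bounds the length: fixing
    the coordinates one at a time leads from [F(w)] to the simple module at [w] and
    creates no cohomology above degree [N] ([corner_exact]), while for a minimal [G]
    all cochains with simple coefficients are cocycles and only zero is a coboundary,
    so that [G_j = 0] for [j > N] ([radical_resolution_zero]). *)

(** * Finite-dimensional linear algebra *)

Section LinearAlgebra.
Context (K : fieldType).
Implicit Types (U V W : lmodType K).

Lemma exists_linear U V (f : U -> V) :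
  linear f -> exists g : {linear U -> V}, g =1 f.
Proof.
move=> lf; pose m := GRing.isLinear.Build K U V *:%R f lf.
pose g : {linear U -> V} := HB.pack f m.
by exists g.
Qed.

Lemma findim_coordinates V : findim V ->
  exists (n : nat) (b : 'I_n -> V),
    forall x, exists c : 'I_n -> K, x = \sum_i c i *: b i.
Proof.
move=> [n [b sb]]; exists n, b => x.
have [m [v [c [bv ->]]]] := sb x.
have {bv} /choice[k kP] i : exists k, b k = v i by have [k _ <-] := bv i; exists k.
exists (fun j => \sum_(i | k i == j) c i).
rewrite (partition_big k xpredT) //=; apply: eq_bigr => j _.
by rewrite scaler_suml; apply: eq_bigr => i /eqP <-; rewrite kP.
Qed.

(** Induction on the number of vectors [b i] that are missing from the image of
    [f]: a missing vector is added to the image at the cost of one dimension in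
    the source, with the value of the functional there chosen so that it still
    vanishes on the kernel. *)
Lemma factor_functional_span n W (b : 'I_n -> W) U (f : {linear U -> W})
    (l : {linear U -> K^o}) :
  (forall u, f u = 0 -> l u = 0) ->
  (forall w, exists u c, w = f u + \sum_i c i *: b i) ->
  exists m : {linear W -> K^o}, forall u, l u = m (f u).
Proof.
elim: n b U f l => [|n IH] b U f l fl span.
  have /choice[s sP] w : exists u, w = f u.
    by have [u [c ->]] := span w; exists u; rewrite big_ord0 addr0.
  have lE u v : f u = f v -> l u = l v.
    by move=> E; apply/eqP; rewrite -subr_eq0 -linearB fl // linearB E subrr.
  have [m mP] : exists m : {linear W -> K^o}, m =1 l \o s.
    by apply: exists_linear => a x y /=; rewrite -linearP; apply: lE;
       rewrite -sP linearP -!sP.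
  by exists m => u; rewrite mP /=; apply: lE; rewrite -sP.
have [f' f'P] : exists f' : {linear (U * K^o)%type -> W},
    f' =1 fun x => f x.1 + x.2 *: b ord0.
  apply: exists_linear => a x y /=.
  by rewrite linearP scalerDr scalerDl scalerA addrACA.
have [u0 u0P] : exists u0, (exists u, f u = b ord0) -> f u0 = b ord0.
  by have [[u uP]|no] := pselect (exists u, f u = b ord0); [exists u|exists 0].
have [l' l'P] : exists l' : {linear (U * K^o)%type -> K^o},
    l' =1 fun x => l x.1 + x.2 *: l u0.
  apply: exists_linear => a x y /=.
  by rewrite linearP scalerDr scalerDl scalerA addrACA.
have [[u u1]|x|m mP] := IH (fun i => b (lift ord0 i)) _ f' l'.
- rewrite f'P l'P /= => E.
  have [bf|nbf] := pselect (exists u, f u = b ord0).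
    have <- : l (u + u1 *: u0) = l u + u1 *: l u0 by rewrite linearD linearZ.
    by apply: fl; rewrite linearD linearZ /= u0P.
  have [u10|u1n0] := eqVneq u1 0.
    by move: E; rewrite u10 !scale0r !addr0; apply: fl.
  case: nbf; exists (- u1^-1 *: u); rewrite linearZ /=.
  move/eqP: E; rewrite addr_eq0 => /eqP ->.
  by rewrite scalerN scaleNr opprK scalerA mulVf // scale1r.
- have [u [c ->]] := span x; exists (u, c ord0), (fun i => c (lift ord0 i)).
  by rewrite f'P /= big_ord_recl addrA.
- exists m => u; have := mP (u, 0).
  by rewrite f'P l'P /= !scale0r !addr0.
Qed.

Lemma factor_functional U W (f : {linear U -> W}) (l : {linear U -> K^o}) :
  findim W -> (forall u, f u = 0 -> l u = 0) ->
  exists m : {linear W -> K^o}, forall u, l u = m (f u).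
Proof.
move=> /findim_coordinates [n [b sb]] fl.
apply: (factor_functional_span (b := b)) fl _ => w.
by have [c ->] := sb w; exists 0, c; rewrite linear0 add0r.
Qed.

Lemma nonzero_functional V (x : V) : findim V -> x != 0 ->
  exists m : {linear V -> K^o}, m x = 1.
Proof.
move=> fV x0.
have [f fP] : exists f : {linear K^o -> V}, f =1 fun c => c *: x.
  by apply: exists_linear => a c d /=; rewrite scalerDl scalerA.
have [|m mP] := factor_functional (f := f) (l := idfun) fV.
  by move=> u; rewrite fP => /eqP; rewrite scaler_eq0 (negPf x0) orbF => /eqP.
by exists m; have := mP 1; rewrite fP scale1r.
Qed.

(** A biorthogonal family factors the identity matrix of its size through the
    dimension of the space. *)
Lemma biorthogonal_bound V : findim V ->
  exists n, forall m (v : 'I_m -> V) (e : 'I_m -> {linear V -> K^o}),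
    (forall i j, e j (v i) = (i == j)%:R) -> (m <= n)%N.
Proof.
move=> /findim_coordinates [n [b sb]]; exists n => m v e ev.
have /choice[c cP] i : exists c : 'I_n -> K, v i = \sum_j c j *: b j by exact: sb.
have E : (\matrix_(i, k) c i k) *m (\matrix_(k, j) e j (b k)) = 1%:M :> 'M[K]_m.
  apply/matrixP => i j; rewrite !mxE -ev cP linear_sum.
  by apply: eq_bigr => k _; rewrite !mxE linearZ.
by rewrite -(mxrank1 K m) -E (leq_trans (mxrankM_maxl _ _)) ?rank_leq_col.
Qed.

End LinearAlgebra.

(** * Interval modules *)

Section UnitSpaces.
Context (K : fieldType).

Lemma vunit_map_comp b c d x : (b && d ==> c) ->
  vunit_map K c d (vunit_map K b c x) = vunit_map K b d x.
Proof. by case: b x; case: c; case: d => //= x _; rewrite linear0. Qed.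

Lemma vunit_map_scalar (c d : bool) (x : K^o) : (d ==> c) ->
  vunit_map K c d (vunit_map K true c x) = vunit_map K true d x.
Proof. by move=> dc; refine (@vunit_map_comp true c d x dc). Qed.

Lemma vunit_map_square (b c b' d : bool) (x : vunit K b) : (b -> d -> c = b') ->
  vunit_map K c d (vunit_map K b c x) = vunit_map K b' d (vunit_map K b b' x).
Proof.
case: b x => x; last by rewrite !linear0.
case: d => [/(_ isT isT) -> //|_].
by rewrite [LHS]thinmx0 [RHS]thinmx0.
Qed.

Lemma vunit_map_id b x : vunit_map K b b x = x.
Proof. by case: b x => //= x; rewrite [RHS]thinmx0. Qed.

Lemma vunit_map_inj b c x : (b ==> c) -> vunit_map K b c x = 0 -> x = 0.
Proof. by case: b x; case: c => //= x _ _; rewrite [LHS]thinmx0. Qed.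

Lemma vunit_false b (x : vunit K b) : ~~ b -> x = 0.
Proof. by case: b x => // x _; rewrite [LHS]thinmx0. Qed.

Lemma vunit_scalar b (x : vunit K b) :
  x = (vunit_map K b true x : K) *: vunit_map K true b 1.
Proof.
case: b x => /= x; last by rewrite [LHS]thinmx0 [RHS]thinmx0.
by rewrite -[RHS]/(_ * 1) mulr1.
Qed.

End UnitSpaces.

Arguments vunit_map : simpl never.

Definition convex_region (N : nat) (A : pred (grade N)) : Prop :=
  forall u v w, gle u v -> gle v w -> A u -> A w -> A v.

Section Intervals.
Context (K : fieldType) (N : nat).
Implicit Types (A B U Q D : pred (grade N)).

Fact interval_id A z (h : gle z z) x : vunit_map K (A z) (A z) x = x.
Proof. exact: vunit_map_id. Qed.
Fact interval_comp A (cA : convex_region A) u v w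
    (h : gle u v) (h' : gle v w) (h'' : gle u w) x :
  vunit_map K (A v) (A w) (vunit_map K (A u) (A v) x) = vunit_map K (A u) (A w) x.
Proof. by apply: vunit_map_comp; apply/implyP => /andP[]; apply: cA. Qed.
Definition interval A (cA : convex_region A) : functor K N :=
  @Functor K N (fun v => vunit K (A v)) (fun v w _ => vunit_map K (A v) (A w))
    (@interval_id A) (@interval_comp A cA).

Lemma functor_eq (F : grade N -> lmodType K)
    (s : forall z w, gle z w -> {linear F z -> F w}) i c i' c' :
  @Functor K N F s i c = @Functor K N F s i' c'.
Proof. by congr Functor; apply: Prop_irrelevance. Qed.

Lemma interval_eq A B (cA : convex_region A) (cB : convex_region B) :
  A =1 B -> interval cA = interval cB.
Proof. by move=> /funext E; subst B; apply: functor_eq. Qed.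

Lemma shift_convex A z : convex_region A -> convex_region (fun v => A (z + v)).
Proof.
by move=> cA u v w uv vw; apply: cA; apply: gle_addl.
Qed.

Lemma shift_interval A (cA : convex_region A) z :
  shift (interval cA) z = interval (@shift_convex A z cA).
Proof. exact: functor_eq. Qed.

Section IntervalMap.
Context A B (cA : convex_region A) (cB : convex_region B).
Hypothesis AB : forall v w, gle v w -> A v -> B w -> A w = B v.

Fact interval_map_natural v w (h : gle v w) x :
  vunit_map K (A w) (B w) (smap (interval cA) h x) =
  smap (interval cB) h (vunit_map K (A v) (B v) x).
Proof. by apply: vunit_map_square; apply: AB. Qed.
Definition interval_map : mor (interval cA) (interval cB) :=
  @Mor K N (interval cA) (interval cB) (fun v => vunit_map K (A v) (B v))
    interval_map_natural.
End IntervalMap.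

End Intervals.

Section ShortExact.
Context (K : fieldType) (N : nat).
Implicit Types (L M : functor K N).

Definition short_exact (A B C : functor K N) (a : mor A B) (b : mor B C) : Prop :=
  [/\ forall z x, a z x = 0 -> x = 0,
      forall z y, b z y = 0 <-> exists x, a z x = y &
      forall z c, exists y, b z y = c].

Fact shift_mor_natural L M (f : mor L M) z v w (h : gle v w) x :
  f (z + w) (smap (shift L z) h x) = smap (shift M z) h (f (z + v) x).
Proof. exact: app_natural. Qed.
Definition shift_mor L M (f : mor L M) z : mor (shift L z) (shift M z) :=
  @Mor K N (shift L z) (shift M z) (fun v => f (z + v)) (@shift_mor_natural L M f z).

Lemma shift_short_exact A B C (a : mor A B) (b : mor B C) z :
  short_exact a b -> short_exact (shift_mor a z) (shift_mor b z).
Proof. by move=> [a0 ab b1]; split=> v; [apply: a0|apply: ab|apply: b1]. Qed.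

(** An interval is cut into an upper part, which gives a submodule, and a lower
    part, which gives the quotient. *)
Lemma interval_short_exact (U Q D : pred (grade N)) (cU : convex_region U)
    (cQ : convex_region Q) (cD : convex_region D) :
  (forall v, Q v = U v || D v) -> (forall v w, gle v w -> U v -> ~~ D w) ->
  exists (a : mor (interval K cU) (interval K cQ))
         (b : mor (interval K cQ) (interval K cD)), short_exact a b.
Proof.
move=> QUD UD.
have UQ v w : gle v w -> U v -> Q w -> U w = Q v.
  by move=> /UD vw Uv; rewrite !QUD (negPf (vw Uv)) Uv orbF.
have QD v w : gle v w -> Q v -> D w -> Q w = D v.
  move=> vw; rewrite !QUD => /orP[/(UD _ _ vw)/negPf->//|-> ->].
  by rewrite orbT.
exists (interval_map K cU cQ UQ), (interval_map K cQ cD QD); split=> [z x|z y|z c] /=.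
- by apply: vunit_map_inj; rewrite QUD; case: (U z).
- split=> [y0|[x <-]]; last first.
    have := UD z z (gle_refl z); move: x; case: (U z) => x.
      by move=> /(_ isT) Dz; apply: vunit_false.
    by rewrite !linear0.
  exists (vunit_map K (Q z) (U z) y).
  have [Uz|nUz] := boolP (U z).
    rewrite vunit_map_comp; last by rewrite implybT.
    exact: vunit_map_id.
  have -> : y = 0 by move: y0; apply: vunit_map_inj; rewrite QUD (negPf nUz) implybb.
  by rewrite !linear0.
- exists (vunit_map K (D z) (Q z) c).
  rewrite vunit_map_comp; first exact: vunit_map_id.
  by rewrite QUD; case: (D z); rewrite ?orbT.
Qed.

End ShortExact.

Section Boxes.
Context (N : nat).

Definition box (P : 'I_N -> pred int) : pred (grade N) :=
  fun v => [forall i, P i (v ord0 i)].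

Definition int_convex (p : pred int) : Prop :=
  forall x y z, x <= y -> y <= z -> p x -> p z -> p y.

Lemma box_convex P : (forall i, int_convex (P i)) -> convex_region (box P).
Proof.
move=> cP u v w /forallP uv /forallP vw /forallP Pu /forallP Pw.
by apply/forallP => i; apply: cP (uv i) (vw i) (Pu i) (Pw i).
Qed.

Lemma box_split P i v :
  box P v = P i (v ord0 i) && [forall (k | k != i), P k (v ord0 k)].
Proof.
apply/forallP/andP => [Pv|[Pi /forall_inP Pk] k]; last first.
  by have [->|/Pk] := eqVneq k i.
by split; [exact: Pv|apply/forall_inP => k _; exact: Pv].
Qed.

Section Cut.
Context (U Q D : 'I_N -> pred int) (i : 'I_N).
Hypothesis offU : forall k, k != i -> Q k =1 U k.
Hypothesis offD : forall k, k != i -> Q k =1 D k.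
Hypothesis QUD : forall x, Q i x = U i x || D i x.
Hypothesis UD : forall x y, x <= y -> U i x -> ~~ D i y.

Lemma box_cut v : box Q v = box U v || box D v.
Proof.
have off P : (forall k, k != i -> Q k =1 P k) ->
    [forall (k | k != i), P k (v ord0 k)] = [forall (k | k != i), Q k (v ord0 k)].
  by move=> QP; apply: eq_forallb_in => k /QP ->.
by rewrite !(box_split _ i) !off // QUD andb_orl.
Qed.

Lemma box_above v w : gle v w -> box U v -> ~~ box D w.
Proof.
move=> /forallP vw /forallP Uv; apply/negP => /forallP /(_ i).
by apply/negP; apply: UD (vw i) (Uv i).
Qed.

End Cut.

End Boxes.

Lemma box_short_exact (K : fieldType) (N : nat) (U Q D : 'I_N -> pred int)
    (cU : convex_region (box U)) (cQ : convex_region (box Q))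
    (cD : convex_region (box D)) i :
  (forall k, k != i -> Q k =1 U k /\ Q k =1 D k) ->
  (forall x, Q i x = U i x || D i x) ->
  (forall x y, x <= y -> U i x -> ~~ D i y) ->
  exists (a : mor (interval K cU) (interval K cQ))
         (b : mor (interval K cQ) (interval K cD)), short_exact a b.
Proof.
move=> off QUD UD; apply: interval_short_exact; last exact: box_above UD.
by apply: box_cut QUD => k /off[].
Qed.

Lemma free1_interval (K : fieldType) (N : nat) (w : grade N)
    (P : 'I_N -> pred int) (cP : convex_region (box P)) :
  (forall i x, P i x = (w ord0 i <= x)) -> interval K cP = free1 K w.
Proof.
move=> Pw.
have cw : convex_region (gle w) by move=> u v t uv _ wu _; apply: gle_trans wu uv.
rewrite (interval_eq K cP cw); last by move=> v; apply: eq_forallb => i.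
exact: functor_eq.
Qed.

(** Maps into the module of the principal downset at [t] are linear functionals at
    [t]. *)
Section Cofree.
Context (K : fieldType) (N : nat) (t : grade N) (A : pred (grade N)).
Context (cA : convex_region A) (At : forall v, A v = gle v t) (V : functor K N).

Definition smap_or0 (M : functor K N) v w : {linear M v -> M w} :=
  if pselect (gle v w) is left h then smap M h else (\0 : {linear M v -> M w}).

Lemma smap_or0E (M : functor K N) v w (h : gle v w) x : smap_or0 M v w x = smap M h x.
Proof.
by rewrite /smap_or0; case: pselect => // h'; rewrite (Prop_irrelevance h h').
Qed.

Lemma cofree_mor (l : {linear V t -> K^o}) :
  exists f : mor V (interval K cA), forall x, vunit_map K (A t) true (f t x) = l x.
Proof.
pose f v : {linear V v -> interval K cA v} :=
  vunit_map K true (A v) \o (l \o smap_or0 V v t).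
have fn v w (h : gle v w) x : f w (smap V h x) = smap (interval K cA) h (f v x).
  have [Aw|nAw] : A w \/ ~~ A w by case: (A w); [left|right].
    have wt : gle w t by rewrite -At.
    have vt := gle_trans h wt; have Av : A v by rewrite At.
    rewrite /f /= !smap_or0E (smap_comp _ _ vt); apply/esym/vunit_map_scalar.
    by rewrite Av implybT.
  by rewrite [LHS]vunit_false // [RHS]vunit_false.
exists (Mor fn) => x; rewrite /= vunit_map_scalar ?At ?gle_refl //.
by rewrite /vunit_map /= (smap_or0E (gle_refl t)) smap_id.
Qed.

Lemma cofree_mor_eq (f f' : mor V (interval K cA)) :
  (forall x, f t x = f' t x) -> f = f'.
Proof.
move=> ff; apply: morP => v x; apply/eqP; rewrite -subr_eq0; apply/eqP.
have [Av|/vunit_false //] := boolP (A v); last exact.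
have vt : gle v t by rewrite -At.
apply: (@vunit_map_inj _ (A v) (A t)); first by rewrite [A t]At gle_refl implybT.
rewrite linearB; apply/eqP; rewrite subr_eq0; apply/eqP.
have := app_natural f vt x; have := app_natural f' vt x; rewrite /= => <- <-.
exact: ff.
Qed.

End Cofree.

(** * Free modules *)

Section DirectSumElim.
Context (K : fieldType) (I : choiceType) (V : I -> lmodType K) (W : lmodType K).
Context (t : forall i, {linear V i -> W}).

Definition dsupp (x : dsum V) : {fset I} := fset_set [set i | x i != 0]%classic.

Lemma dsuppP (x : dsum V) i : (i \in dsupp x) = (x i != 0).
Proof.
by rewrite in_fset_set ?mem_setE //; exact: dval_finite.
Qed.

Lemma dsum_elim_widen (x : dsum V) (B : {fset I}) : (dsupp x `<=` B)%fset ->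
  \sum_(i <- dsupp x) t i (x i) = \sum_(i <- B) t i (x i).
Proof.
move=> sB; apply: big_fset_incl => // i _.
by rewrite dsuppP negbK => /eqP ->; rewrite linear0.
Qed.

(** The universal property of the direct sum as a coproduct.  The support of an element
    depends on the element, so additivity is checked over a common larger index set. *)
Lemma exists_dsum_elim : exists f : {linear dsum V -> W},
  forall x, f x = \sum_(i <- dsupp x) t i (x i).
Proof.
apply: exists_linear => a x y /=.
pose B := (dsupp x `|` dsupp y `|` dsupp (a *: x + y)%R)%fset.
rewrite !(@dsum_elim_widen _ B) /B; first last.
- by rewrite fsubsetUr.
- by rewrite -fsetUA fsubsetUl.
- by rewrite -fsetUA fsetUCA fsubsetUl.
by rewrite scaler_sumr -big_split; apply: eq_bigr => i _; rewrite linearP.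
Qed.

End DirectSumElim.

Definition rank_one (K : fieldType) (U W : lmodType K) (l : {linear U -> K^o})
  (w : W) (u : U) : W := (l u : K) *: w.
Fact rank_one_linear (K : fieldType) (U W : lmodType K) (l : {linear U -> K^o})
  (w : W) : linear (rank_one l w).
Proof. by move=> a u v; rewrite /rank_one linearP scalerDl scalerA. Qed.
HB.instance Definition _ (K : fieldType) (U W : lmodType K) (l : {linear U -> K^o})
    (w : W) :=
  GRing.isLinear.Build K U W *:%R (rank_one l w) (rank_one_linear l w).

Section FreeBasis.
Context (K : fieldType) (N : nat).
Implicit Types (P L M X : functor K N).

(** The universal property of a basis.  Lifts, dual bases and maps to simple modules
    are all constructed from it, without reference to a direct sum decomposition. *)
Definition is_basis P (I : Type) (g : I -> grade N) (e : forall i, P (g i)) : Prop :=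
  (forall X (x : forall i, X (g i)), exists f : mor P X, forall i, f _ (e i) = x i) /\
  (forall X (f f' : mor P X), (forall i, f _ (e i) = f' _ (e i)) -> f = f').

Definition free1_unit (w : grade N) : free1 K w w := vunit_map K true (gle w w) 1.

Lemma free1_unit_smap w v (h : gle w v) :
  smap (free1 K w) h (free1_unit w) = vunit_map K true (gle w v) 1.
Proof. by apply: vunit_map_scalar; rewrite gle_refl implybT. Qed.

Lemma free1_unit_neq0 w : free1_unit w != 0.
Proof.
apply/eqP => /(congr1 (vunit_map K (gle w w) true)).
rewrite vunit_map_scalar ?gle_refl // linear0 /vunit_map /= => /eqP.
by rewrite oner_eq0.
Qed.

Lemma free1_mor X w (x : X w) :
  exists f : mor (free1 K w) X, f w (free1_unit w) = x.
Proof.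
pose f v : {linear free1 K w v -> X v} :=
  rank_one (vunit_map K (gle w v) true) (smap_or0 X w v x).
have fn u v (h : gle u v) y : f v (smap (free1 K w) h y) = smap X h (f u y).
  have [wu|nwu] : gle w u \/ ~~ gle w u by case: (gle w u); [left|right].
    have wv := gle_trans wu h.
    rewrite /f /= /rank_one linearZ /= (smap_or0E wu) (smap_or0E wv) (smap_comp _ _ wv).
    congr (_ *: _); refine (@vunit_map_comp K (gle w u) (gle w v) true y _).
    by rewrite wu wv.
  by rewrite (vunit_false y) // !linear0.
exists (Mor fn); rewrite /= /rank_one vunit_map_scalar ?gle_refl //.
by rewrite (smap_or0E (gle_refl _)) smap_id /vunit_map /= scale1r.
Qed.

Lemma free1_mor_eq X w (f f' : mor (free1 K w) X) :
  f w (free1_unit w) = f' w (free1_unit w) -> f = f'.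
Proof.
move=> ff; apply: morP => v y.
have [wv|nwv] : gle w v \/ ~~ gle w v by case: (gle w v); [left|right].
  rewrite (vunit_scalar y) -(free1_unit_smap wv) !linearZ; congr (_ *: _).
  by rewrite !app_natural ff.
by rewrite (vunit_false y) // !linear0.
Qed.

Section DirectSumBasis.
Context (I : choiceType) (g : I -> grade N).
Local Notation F := (direct_sum (fun i => free1 K (g i))).

Fact basis_element_finite (i : I) :
  finite_set [set j | (if j == i then vunit_map K true (gle (g j) (g i)) 1 else 0)
                      != 0]%classic.
Proof.
apply: (@sub_finite_set _ _ [set i]%classic) => [j /=|]; last exact: finite_set1.
by case: (j =P i) => // _ /negP[].
Qed.
Definition basis_element i : F (g i) := DSum (@basis_element_finite i).

Lemma free_mor X (x : forall i, X (g i)) :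
  exists f : mor F X, forall i, f _ (basis_element i) = x i.
Proof.
pose m i := sval (cid (free1_mor (x i))).
have mP i : m i _ (free1_unit (g i)) = x i := svalP (cid (free1_mor (x i))).
pose f v : {linear F v -> X v} := sval (cid (exists_dsum_elim (fun i => m i v))).
have fE v y : f v y = \sum_(i <- dsupp y) m i v (y i).
  exact: svalP (cid (exists_dsum_elim (fun i => m i v))) y.
have fn v w (h : gle v w) y : f w (smap F h y) = smap X h (f v y).
  rewrite !fE (@dsum_elim_widen _ _ _ _ _ _ (dsupp y)); last first.
    apply/fsubsetP => i; rewrite !dsuppP; apply: contra => /eqP yi.
    by rewrite /= yi linear0.
  by rewrite linear_sum; apply: eq_bigr => i _; rewrite -app_natural.
exists (Mor fn) => i; rewrite /= fE (@dsum_elim_widen _ _ _ _ _ _ [fset i]%fset).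
  by rewrite big_seq_fset1 /= eqxx mP.
apply/fsubsetP => j; rewrite dsuppP inE /=.
by case: (j == i); rewrite // eqxx.
Qed.

Lemma basis_element_expansion v (y : F v) :
  y = \sum_(i <- dsupp y)
    (vunit_map K (gle (g i) v) true (y i) : K) *: smap_or0 F (g i) v (basis_element i).
Proof.
apply: dsumP => j; rewrite (big_morph (fun x : dsum _ => x j) (id1 := 0) (op1 := +%R)) //.
have E i : i != j ->
    ((vunit_map K (gle (g i) v) true (y i) : K) *:
      smap_or0 F (g i) v (basis_element i)) j = 0.
  move=> ij; rewrite /= /smap_or0; case: pselect => [h|_] /=.
    by rewrite eq_sym (negPf ij) linear0 scaler0.
  exact: scaler0.
have [yj|] := boolP (j \in dsupp y); last first.
  rewrite dsuppP negbK => yj; rewrite (eqP yj) big1_seq // => i /andP[_ yi].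
  by apply: E; apply: contraTneq yi => ->; rewrite dsuppP (eqP yj) eqxx.
rewrite (bigD1_seq j) //= big1 => [|i /E //]; rewrite addr0.
have [jv|njv] : gle (g j) v \/ ~~ gle (g j) v by case: (gle (g j) v); [left|right].
  rewrite (smap_or0E jv) /= eqxx [LHS]vunit_scalar; congr (_ *: _).
  by apply/esym/vunit_map_scalar; rewrite gle_refl implybT.
by rewrite [LHS]vunit_false // [RHS]vunit_false.
Qed.

Lemma free_mor_eq X (f f' : mor F X) :
  (forall i, f _ (basis_element i) = f' _ (basis_element i)) -> f = f'.
Proof.
move=> ff; apply: morP => v y; rewrite (basis_element_expansion y) !linear_sum.
apply: eq_bigr => i _; rewrite !linearZ; congr (_ *: _).
rewrite /smap_or0; case: pselect => [h|_]; last by rewrite /= !linear0.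
by rewrite !app_natural ff.
Qed.

Lemma direct_sum_basis : is_basis basis_element.
Proof. by split; [exact: free_mor|exact: free_mor_eq]. Qed.

(** Only the basis elements in the degree of an element can contribute to its image
    in a module concentrated in that degree. *)
Lemma free_mor_concentrated X z (f : mor F X) (y : F z) :
  (forall v (x : X v), v != z -> x = 0) -> (forall i, g i = z -> y i = 0) ->
  f z y = 0.
Proof.
move=> X0 y0; rewrite (basis_element_expansion y) linear_sum big1 // => i _.
rewrite linearZ /=; have [/y0 ->|giz] := eqVneq (g i) z.
  by rewrite linear0 scale0r.
rewrite /smap_or0; case: pselect => [h|_] /=; last by rewrite linear0 scaler0.
by rewrite app_natural (X0 _ (f _ _) giz) linear0 scaler0.
Qed.

End DirectSumBasis.

Lemma basis_iso P M (I : Type) (g : I -> grade N) (e : forall i, M (g i))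
    (f : mor P M) (h : mor M P) :
  hcomp h f = hid P -> hcomp f h = hid M -> is_basis e ->
  is_basis (fun i => h _ (e i)).
Proof.
move=> hf fh [ex un].
have fhE v x : f v (h v x) = x by have := congr1 (fun k : mor M M => k v x) fh.
have hfE v x : h v (f v x) = x by have := congr1 (fun k : mor P P => k v x) hf.
split=> [X x|X k k' kk].
  by have [k kP] := ex X x; exists (hcomp k f) => i; rewrite /= fhE kP.
have E : hcomp k h = hcomp k' h by apply: un => i; exact: kk.
apply: morP => v x; rewrite -(hfE v x).
exact: (congr1 (fun k : mor M X => k v (f v x)) E).
Qed.

Lemma free_module_basis P : free_module P ->
  exists (I : choiceType) (g : I -> grade N) (e : forall i, P (g i)), is_basis e.
Proof.
move=> [I [g [f [h [hf fh]]]]].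
exists {classic I}, g, (fun i => h _ (@basis_element {classic I} g i)).
exact: basis_iso hf fh (@direct_sum_basis {classic I} g).
Qed.

Lemma finite_rank_basis P : finite_rank_free P ->
  exists n (g : 'I_n -> grade N) (e : forall i, P (g i)), is_basis e.
Proof.
move=> [n [g [f [h [hf fh]]]]]; exists n, g, (fun i => h _ (basis_element g i)).
exact: basis_iso hf fh (@direct_sum_basis _ g).
Qed.

(** Lifting against [b] is asked only for maps with values in the image of [b], so
    that this covers lifts through epimorphisms, kernels and images alike. *)
Definition projective P : Prop :=
  forall B C (b : mor B C) (f : mor P C), (forall v x, exists y, b v y = f v x) ->
  exists h : mor P B, forall v x, b v (h v x) = f v x.

Lemma free_projective P : free_module P -> projective P.
Proof.
move=> /free_module_basis [I [g [e [ex un]]]] B C b f bf.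
have [h hP] := ex B (fun i => sval (cid (bf _ (e i)))).
have E : hcomp b h = f.
  by apply: un => i; rewrite /= hP; exact: svalP (cid (bf _ (e i))).
by exists h => v x; rewrite -E.
Qed.

Lemma bijective_inverse L M (f : mor L M) :
  (forall z x, f z x = 0 -> x = 0) -> (forall z y, exists x, f z x = y) ->
  exists h : mor M L, hcomp h f = hid L /\ hcomp f h = hid M.
Proof.
move=> f0 f1; pose h z y := sval (cid (f1 z y)).
have fh z y : f z (h z y) = y := svalP (cid (f1 z y)).
have finj z x y : f z x = f z y -> x = y.
  by move=> E; apply/eqP; rewrite -subr_eq0; apply/eqP/f0; rewrite linearB E subrr.
have lin z : linear (h z) by move=> a x y; apply: (finj); rewrite linearP !fh.
pose hl z := sval (cid (exists_linear (lin z))).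
have hlE z y : hl z y = h z y by rewrite /hl; case: cid.
have hn z w (zw : gle z w) y : hl w (smap M zw y) = smap L zw (hl z y).
  by apply: finj; rewrite !hlE fh app_natural fh.
exists (Mor hn); split; apply: morP => z x /=; last by rewrite hlE fh.
by apply: finj; rewrite hlE fh.
Qed.

End FreeBasis.

Section FreeDual.
Context (K : fieldType) (N : nat).
Implicit Types (P X : functor K N).

Lemma gle_dual (g z : grade N) : gle (gone N) (z + g) = gle (gone N - g) z.
Proof.
by apply: eq_forallb => i; rewrite !mxE lerBlDr.
Qed.

Section Basis.
Context P (I : choiceType) (g : I -> grade N) (e : forall i, P (g i)).
Hypothesis eb : is_basis e.
Local Notation F1 := (free1 K (gone N)).
Local Notation dg i := (gone N - g i).

Lemma dual_eval z i : exists f : {linear global_dual P z -> K^o},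
  forall x : global_dual P z, f x = vunit_map K (gle (gone N) (z + g i)) true (x _ (e i)).
Proof. by apply: exists_linear => a x y; rewrite -linearP. Qed.

(** The functionals dual to basis elements of these degrees are biorthogonal to the
    evaluations at the basis elements. *)
Lemma dual_degrees_finite : persistence_module (global_dual P) ->
  forall z, finite_set [set i | gle (dg i) z]%classic.
Proof.
move=> fP z; have [n bound] := biorthogonal_bound (fP z).
apply: contrapT => /(infinite_set_fset n.+1) [B BA Bn].
pose i0 (k : 'I_(size B)) := tnth (in_tuple B) k.
have i0B k : gle (dg (i0 k)) z by apply: BA; exact: mem_tnth.
have i0inj k l : (i0 k == i0 l) = (k == l).
  by apply: inj_eq; apply/tuple_uniqP; exact: fset_uniq.
have [ex _] := eb.
pose v k : global_dual P z := sval (cid (ex (shift F1 z) (fun j =>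
  if j == i0 k then vunit_map K true (gle (gone N) (z + g j)) 1 else 0))).
have vE k j : v k _ (e j) =
    if j == i0 k then vunit_map K true (gle (gone N) (z + g j)) 1 else 0.
  by rewrite /v; case: cid => /= f ->.
pose ev k := sval (cid (dual_eval z (i0 k))).
suff: (#|` B| <= n)%N by rewrite leqNgt Bn.
apply: (bound _ v ev) => k l.
rewrite /ev; case: cid => /= f ->; rewrite vE i0inj eq_sym.
case: eqP => _; last by rewrite linear0.
by rewrite vunit_map_scalar // gle_dual i0B.
Qed.

(** A functional is the family of its values on the basis, so the dual is a product of
    free modules of rank one.  The finiteness condition makes it a direct sum.  The
    last clause records that the coordinates of a functional are these values. *)
Lemma dual_free : (forall z, finite_set [set i | gle (dg i) z]%classic) ->
  exists (d : mor (global_dual P) (direct_sum (fun i => free1 K (dg i))))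
         (h : mor (direct_sum (fun i => free1 K (dg i))) (global_dual P)),
    [/\ hcomp h d = hid _, hcomp d h = hid _ &
        forall z (f : global_dual P z) i, f _ (e i) = 0 -> (d z f : dsum _) i = 0].
Proof.
move=> fin; have [ex un] := eb.
pose c z (f : global_dual P z) i : free1 K (dg i) z :=
  vunit_map K (gle (gone N) (z + g i)) (gle (dg i) z) (f _ (e i)).
have cfin z f : finite_set [set i | c z f i != 0]%classic.
  apply: sub_finite_set (fin z) => i /=; apply: contraNT => /vunit_false c0.
  exact/eqP/c0.
pose d z (f : global_dual P z) : direct_sum (fun i => free1 K (dg i)) z :=
  DSum (cfin z f).
have dlin z : linear (d z).
  by move=> a f f'; apply: dsumP => i; rewrite /= /c linearP.
pose dl z := sval (cid (exists_linear (dlin z))).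
have dlE z f i : (dl z f : dsum _) i = c z f i by rewrite /dl; case: cid => /= h ->.
have dn z w (h : gle z w) f :
    dl w (smap (global_dual P) h f) = smap (direct_sum (fun i => free1 K (dg i))) h (dl z f).
  apply: dsumP => i; rewrite /= !dlE /c.
  refine (@vunit_map_square K _ (gle (gone N) (w + g i)) _ _ (f (g i) (e i)) _).
  by rewrite !gle_dual => -> ->.
have [||h [hd dh]] := bijective_inverse (f := Mor dn).
- move=> z /= f f0; apply: un => i; apply: (@vunit_map_inj K _ (gle (dg i) z)).
    by rewrite gle_dual implybb.
  by rewrite -/(c z f i) -dlE f0.
- move=> z y /=.
  have [f fE] := ex (shift F1 z) (fun i =>
    vunit_map K (gle (dg i) z) (gle (gone N) (z + g i)) (y i)).
  exists f; apply: dsumP => i; rewrite dlE /c fE.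
  rewrite -[RHS](@vunit_map_id K (gle (dg i) z)).
  by apply: vunit_map_comp; rewrite andbb gle_dual implybb.
by exists (Mor dn), h; split=> // z f i f0; rewrite /= dlE /c f0 linear0.
Qed.

End Basis.

Lemma dual_free_module P : free_module P -> persistence_module (global_dual P) ->
  free_module (global_dual P).
Proof.
move=> /free_module_basis [I [g [e eb]]] fP.
have [d [h [hd dh _]]] := dual_free eb (dual_degrees_finite eb fP).
by exists I, (fun i => gone N - g i), d, h.
Qed.

Lemma dual_finite_rank_free P : finite_rank_free P -> finite_rank_free (global_dual P).
Proof.
move=> /finite_rank_basis [n [g [e eb]]]; exists n, (fun i => gone N - g i).
have [|d [h [hd dh _]]] := dual_free eb; first by move=> z; exact: finite_finset.
by exists d, h.
Qed.

Lemma finite_rank_persistence P : finite_rank_free P -> persistence_module P.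
Proof.
move=> [n [g [f [h [hf _]]]]] z; exists n.
exists (fun i => h z (smap_or0 _ (g i) z (basis_element K g i))) => x.
have hfE : h z (f z x) = x by have := congr1 (fun k : mor P P => k z x) hf.
exists n, (fun i => h z (smap_or0 _ (g i) z (basis_element K g i))).
exists (fun i => vunit_map K (gle (g i) z) true ((f z x : dsum _) i)); split.
  by move=> i; exists i.
rewrite -{1}hfE; move: (f z x) => y.
rewrite {1}(basis_element_expansion y) linear_sum big_uniq ?fset_uniq //=.
rewrite big_mkcond /=; apply: eq_bigr => i _; rewrite linearZ.
case: ifPn => //; rewrite dsuppP negbK => /eqP ->.
by rewrite linear0 scale0r.
Qed.

(** A functional that vanishes on [P_(1-z)] is a combination of translates of dual
    basis elements of degrees other than [z], and those are mapped to zero components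
    of the target. *)
Lemma dual_concentrated P X z (f : global_dual P z) (r : mor (global_dual P) X) :
  finite_rank_free P -> (forall v (x : X v), v != z -> x = 0) ->
  (forall x, f (gone N - z) x = 0) -> r z f = 0.
Proof.
move=> /finite_rank_basis [n [g [e eb]]] X0 f0.
have [|d [h [hd dh d0]]] := dual_free eb; first by move=> v; exact: finite_finset.
have hdE : h z (d z f) = f.
  exact: (congr1 (fun k : mor (global_dual P) (global_dual P) => k z f) hd).
have := free_mor_concentrated (hcomp r h) (y := d z f) X0; rewrite /= hdE; apply.
move=> i giz.
apply: d0; move: (e i); have -> : g i = gone N - z by rewrite -giz opprB addrC subrK.
exact: f0.
Qed.

End FreeDual.

(** * Cohomology of the morphisms from a resolution to a module *)

Section Cochains.
Context (K : fieldType) (N : nat) (G : complex K N).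
Implicit Types (X A B C : functor K N).

Definition cocycle X (j k : int) (h : k = j + 1) (f : mor (G j) X) : Prop :=
  forall z x, f z (bd G h z x) = 0.

Definition coboundary X (i j : int) (h : j = i + 1) (f : mor (G j) X) : Prop :=
  exists g : mor (G i) X, forall z x, f z x = g z (bd G h z x).

(** Vanishing of cohomology in degree [j], for all names [i] and [k] of the
    neighbouring degrees, so that no transport along equations in [int] is needed. *)
Definition hom_exact X (j : int) : Prop :=
  forall i k (h : j = i + 1) (h' : k = j + 1) (f : mor (G j) X),
    cocycle h' f -> coboundary h f.

Lemma hom_exact_zero_term X j : ~ nonzero_functor (G j) -> hom_exact X j.
Proof.
move=> Gj i k h h' f _; exists 0 => z x.
have [->|x0] := eqVneq x 0; first by rewrite !linear0.
by case: Gj; exists z, x.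
Qed.

(** The graph of the connecting homomorphism of [0 -> A -> B -> C -> 0], a relation
    between cocycles that is single-valued only up to coboundaries. *)
Definition connects A B C (a : mor A B) (b : mor B C) (i j : int) (h : j = i + 1)
    (f : mor (G i) C) (f' : mor (G j) A) : Prop :=
  exists2 g : mor (G i) B, forall z x, b z (g z x) = f z x &
    forall z x, g z (bd G h z x) = a z (f' z x).

(** The terms of [G] are projective, so [Hom(G, -)] is exact and has a long exact
    sequence. *)
Section Connecting.
Hypothesis projG : forall i, projective (G i).
Context A B C (a : mor A B) (b : mor B C).
Hypothesis abE : short_exact a b.
Context (i j : int) (h : j = i + 1).
Local Notation connects := (connects a b h).

Lemma connects_cocycle f f' : connects f f' -> cocycle h f.
Proof.
have [_ ab _] := abE; move=> [g gf gf'] z x.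
by rewrite -gf gf'; apply/ab; exists (f' z x).
Qed.

Lemma connects_cocycle_sub k (h' : k = j + 1) f f' : connects f f' -> cocycle h' f'.
Proof.
have [a0 _ _] := abE; move=> [g gf gf'] z x.
by apply: a0; rewrite -gf' bd_bd linear0.
Qed.

Lemma connects_exists f : cocycle h f -> exists f', connects f f'.
Proof.
have [a0 ab b1] := abE; move=> cf.
have [g gf] := projG (b := b) (f := f) (fun z x => b1 z (f z x)).
have [|f' f'P] := projG (b := a) (f := hcomp g (bd G h)).
  by move=> z x; apply/ab; rewrite /= gf cf.
by exists f', g => // z x; rewrite f'P.
Qed.

Lemma connects_exists_quot k (h' : k = j + 1) f' : hom_exact B j ->
  cocycle h' f' -> exists f, connects f f'.
Proof.
move=> exB cf'; have [|g gP] := exB i k h h' (hcomp a f').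
  by move=> z x; rewrite /= cf' linear0.
by exists (hcomp b g), g => // z x; rewrite -gP.
Qed.

Lemma connects_coboundary i' (h' : i = i' + 1) f f' :
  connects f f' -> coboundary h' f -> coboundary h f'.
Proof.
have [a0 ab b1] := abE; move=> [g gf gf'] [t tf].
have [t' t't] := projG (b := b) (f := t) (fun z x => b1 z (t z x)).
have [|s sP] := projG (b := a) (f := g - hcomp t' (bd G h')).
  by move=> z x; apply/ab; rewrite /= linearB /= gf t't tf subrr.
exists s => z x; apply/eqP; rewrite -subr_eq0; apply/eqP/a0.
by rewrite linearB sP /= bd_bd linear0 subr0 gf' subrr.
Qed.

Lemma connects_coboundary_quot i' (h' : i = i' + 1) f f' : hom_exact B i ->
  connects f f' -> coboundary h f' -> coboundary h' f.
Proof.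
have [a0 ab b1] := abE; move=> exB [g gf gf'] [t tf].
have [|s sP] := exB i' j h' h (g - hcomp a t).
  by move=> z x; rewrite /= gf' tf subrr.
exists (hcomp b s) => z x; rewrite /= -sP /= linearB /= gf.
by rewrite [X in _ - X](_ : _ = 0) ?subr0 //; apply/ab; exists (t z x).
Qed.

(** The long exact sequence around a short exact sequence of coefficients, in the two
    places where vanishing of two terms forces vanishing of the third. *)
Lemma hom_exact_quot : hom_exact B i -> hom_exact A j -> hom_exact C i.
Proof.
move=> exB exA i' k h' h''; have Ek : k = j by rewrite h h''.
move: h''; rewrite Ek => h'' f; rewrite (Prop_irrelevance h'' h) => cf.
have [f' ff'] := connects_exists cf.
apply: (connects_coboundary_quot _ exB ff').
by apply: (exA i (j + 1) h erefl); apply: connects_cocycle_sub ff'.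
Qed.

Lemma hom_exact_sub : hom_exact B j -> hom_exact C i -> hom_exact A j.
Proof.
move=> exB exC i' k h' h'' f' cf'.
have Ei : i' = i by apply: (@addIr _ 1); rewrite -h -h'.
move: h'; rewrite Ei => h'; rewrite (Prop_irrelevance h' h).
have [f ff'] := connects_exists_quot exB cf'.
have hi : i = i - 1 + 1 by rewrite subrK.
by apply: (connects_coboundary (h' := hi)) ff' (exC _ _ hi h f (connects_cocycle ff')).
Qed.

End Connecting.
End Cochains.

(** * Translations that kill the resolved module *)

Section Translation.
Context (K : fieldType) (N : nat) (u : grade N).
Hypothesis u_ge0 : forall v, gle v (u + v).
Implicit Types (X L M : functor K N).

Fact translate_natural X v w (h : gle v w) x :
  smap X (u_ge0 w) (smap X h x) = smap (shift X u) h (smap X (u_ge0 v) x).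
Proof. by rewrite /= !(smap_comp _ _ (gle_trans h (u_ge0 w))). Qed.
Definition translate X : mor X (shift X u) :=
  @Mor K N X (shift X u) (fun v => smap X (u_ge0 v)) (@translate_natural X).

Context (G : complex K N) (M : functor K N).
Hypothesis resG : free_resolution G M.
Hypothesis M_killed : forall v (x : M v), smap M (u_ge0 v) x = 0.

(** The translation by [u] of the resolution lifts the zero map of [M], so it is
    null-homotopic. *)
Lemma translate_homotopy (n : nat) (i j k : int) (h : j = i + 1) (h' : k = j + 1) : j = n ->
  exists (s : mor (G j) (shift (G k) u)) (s' : mor (G i) (shift (G j) u)),
  forall v x, bd G h' (u + v) (s v x) + s' v (bd G h v x) = smap (G j) (u_ge0 v) x.
Proof.
have [freeG G_neg [eps [eps1 ker_eps exG]]] := resG.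
have projG l : projective (G l) by apply: free_projective; have [] := freeG l.
elim: n i j k h h' => [|n IH] i j k h h' jn.
  move: h h'; rewrite jn => h h'; have k1 : k = 1 := h'.
  move: h'; rewrite k1 => h'; rewrite (Prop_irrelevance h' erefl).
  have [|s sP] := projG 0 _ _ (shift_mor (bd G (erefl : 1 = 0 + 1 :> int)) u) (translate (G 0)).
    by move=> v x; apply/ker_eps; rewrite /= app_natural M_killed.
  by exists s, 0 => v x; rewrite addr0; exact: sP.
have hi : i = i - 1 + 1 by rewrite subrK.
have [|s [s' sP]] := IH _ i j hi h; first by apply: (@addIr _ 1); rewrite -h jn; lia.
have [|t tP] := projG j _ _ (shift_mor (bd G h') u) (translate (G j) - hcomp s (bd G h)).
  move=> v x; apply/(exG _ _ _ h' h); first by rewrite jn.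
  rewrite /= linearB /= app_natural -(sP v (bd G h v x)) bd_bd linear0 addr0.
  exact: subrr.
by exists t, s => v x; have := tP v x; rewrite /= => ->; rewrite subrK.
Qed.

(** The translation by [u] acts on the cohomology with coefficients in [X] as zero,
    because it is null-homotopic on [G], and injectively, because it has a left
    inverse on [X]. *)
Lemma hom_exact_translate X j (r : mor (shift X u) X) :
  (forall v x, r v (smap X (u_ge0 v) x) = x) -> hom_exact G X j.
Proof.
move=> rP; have [jlt0|jge0] := ltP j 0.
  by apply: hom_exact_zero_term; have [_ + _] := resG; apply.
move=> i k h h' f cf.
have [|s [s' sP]] := @translate_homotopy `|j|%N i j k h h'; first by lia.
exists (hcomp r (hcomp (shift_mor f u) s')) => v x /=.
by rewrite -[LHS]rP -app_natural -sP linearD cf add0r.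
Qed.

End Translation.

(** * Dimension shifting from the lower to the upper orthant *)

Section OrthantRegions.
Context (N : nat).

(** An interpolation between a cofree module, at [k = 0], and a free module, at
    [k = N]. *)
Definition orthant (k : nat) (i : 'I_N) : pred int :=
  fun x => if (i < k)%N then 1 <= x else x <= 0.

(** The union of two consecutive orthants, so that its module is an extension of one
    orthant module by the other. *)
Definition hinge (k : nat) (i : 'I_N) : pred int :=
  fun x => (i == k :> nat) || orthant k i x.

Fact orthant_convex k : convex_region (box (orthant k)).
Proof.
by apply: box_convex => i x y z; rewrite /orthant; case: ifP => _; lia.
Qed.
Fact hinge_convex k : convex_region (box (hinge k)).
Proof.
apply: box_convex => i x y z; rewrite /hinge /orthant.
by case: eqP => //= _; case: ifP => _; lia.
Qed.

Definition axis_step (i : 'I_N) (n : nat) : grade N :=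
  \row_j (if j == i then n%:Z else 0).

Fact axis_step_ge0 i n v : gle v (axis_step i n + v).
Proof. by apply/forallP => j; rewrite !mxE lerDr; case: ifP. Qed.

Lemma orthant0 v : box (orthant 0) v = gle v 0.
Proof. by apply: eq_forallb => i; rewrite /orthant mxE. Qed.

Lemma orthant0_shift z v : box (orthant 0) (z + v) = gle v (- z).
Proof. by rewrite orthant0; apply: eq_forallb => i; rewrite !mxE -lerBrDl sub0r. Qed.

Lemma hinge_periodic (k : 'I_N) n z v :
  box (hinge k) (z + (axis_step k n + v)) = box (hinge k) (z + v).
Proof.
apply: eq_forallb => i; rewrite /hinge !mxE.
by have [->|_] := eqVneq i k; rewrite ?eqxx // add0r.
Qed.

End OrthantRegions.

Section Orthants.
Context (K : fieldType) (N : nat).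
Implicit Types (M V : functor K N).

Definition orthant_module k : functor K N := interval K (@orthant_convex N k).
Definition hinge_module k : functor K N := interval K (@hinge_convex N k).

Lemma orthant_module_free : orthant_module N = free1 K (gone N).
Proof. by apply: free1_interval => i x; rewrite /orthant ltn_ord mxE. Qed.

Lemma hinge_short_exact k : (k < N)%N ->
  exists (a : mor (orthant_module k.+1) (hinge_module k))
         (b : mor (hinge_module k) (orthant_module k)), short_exact a b.
Proof.
move=> kN; apply: (@box_short_exact K N _ _ _ _ _ _ (Ordinal kN)) => [l lk|x|x y]; last first.
- by rewrite /orthant /= ltnSn ltnn; lia.
- by rewrite /hinge /orthant /= ltnSn ltnn eqxx /=; lia.
have /negPf lk' : l != k :> nat by [].
have lkS : (l < k.+1)%N = (l < k)%N by rewrite ltnS leq_eqVlt lk'.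
by split=> x; rewrite /hinge /orthant lk' ?lkS.
Qed.

(** Translation by a period is invertible on the module of a periodic region. *)
Lemma periodic_retraction A (cA : convex_region A) z u (u_ge0 : forall v, gle v (u + v)) :
  (forall v, A (z + (u + v)) = A (z + v)) ->
  exists r : mor (shift (shift (interval K cA) z) u) (shift (interval K cA) z),
    forall (v : grade N) x, r v (smap (shift (interval K cA) z) (u_ge0 v) x) = x.
Proof.
move=> Au.
have rn v w (h : gle v w) (x : vunit K (A (z + (u + v)))) :
    vunit_map K (A (z + (u + w))) (A (z + w))
      (smap (shift (shift (interval K cA) z) u) h x) =
    smap (shift (interval K cA) z) h (vunit_map K (A (z + (u + v))) (A (z + v)) x).
  by apply: vunit_map_square; rewrite !Au => -> ->.
exists (@Mor K N (shift (shift (interval K cA) z) u) (shift (interval K cA) z)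
  (fun v => vunit_map K (A (z + (u + v))) (A (z + v))) rn) => v x.
rewrite /=; transitivity (vunit_map K (A (z + v)) (A (z + v)) x).
  by apply: vunit_map_comp; rewrite Au andbb implybb.
exact: vunit_map_id.
Qed.

(** Below every nonzero component of [M] there is a generator, and above it there is
    the bound of the support, so the support lies in a box. *)
Lemma axis_step_kills M : finitely_generated M -> eventually_vanishes M ->
  exists n, forall i v (h : gle v (axis_step i n + v)) (x : M v), smap M h x = 0.
Proof.
move=> [m [g [s gen]]] [t top].
pose n := (\sum_l \sum_i `|g l ord0 i| + \sum_i `|t ord0 i|)%N.+1.
exists n => i v h x; apply/eqP; apply: contraT => x0.
have /top /forallP /(_ i) : nonzero (M (axis_step i n + v)) by exists (smap M h x).
rewrite !mxE eqxx => vt.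
have {}vt : n%:Z + v ord0 i <= t ord0 i := vt.
have [l gl] : exists l, gle (g l) v.
  have [d [y [c [yP xE]]]] := gen v x; apply: contrapT => no.
  case/eqP: x0; rewrite xE linear_sum big1 // => j _.
  by have [l [gl _]] := yP j; case: no; exists l.
have := forallP gl i.
have : (`|g l ord0 i| <= \sum_l \sum_i `|g l ord0 i|)%N.
  rewrite (bigD1 l) //= (bigD1 i) //= -addnA; exact: leq_addr.
have : (`|t ord0 i| <= \sum_i `|t ord0 i|)%N by rewrite (bigD1 i) //= leq_addr.
move: vt; rewrite /n; lia.
Qed.

Section Shifted.
Context (A : pred (grade N)) (cA : convex_region A) (z : grade N).

Definition unshift : mor (interval K (@shift_convex N A z cA)) (shift (interval K cA) z) :=
  @Mor K N (interval K (@shift_convex N A z cA)) (shift (interval K cA) z)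
    (fun v => idfun) (fun _ _ _ _ => erefl).
Definition reshift : mor (shift (interval K cA) z) (interval K (@shift_convex N A z cA)) :=
  @Mor K N (shift (interval K cA) z) (interval K (@shift_convex N A z cA))
    (fun v => idfun) (fun _ _ _ _ => erefl).

End Shifted.

(** The value of a cochain with coefficients in the shifted lower orthant at the top
    of that orthant, where it is a scalar. *)
Definition top_value z : {linear shift (orthant_module 0) z (- z) -> K^o} :=
  vunit_map K (box (orthant 0) (z - z)) true.

Lemma orthant0_mor V z (l : {linear V (- z) -> K^o}) :
  exists f : mor V (shift (orthant_module 0) z), forall x, top_value z (f (- z) x) = l x.
Proof.
have [f fP] := cofree_mor (@shift_convex N _ z (@orthant_convex N 0)) (orthant0_shift z) l.
by exists (hcomp (unshift _ z) f).
Qed.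

Lemma orthant0_mor_eq V z (f f' : mor V (shift (orthant_module 0) z)) :
  (forall x, top_value z (f (- z) x) = top_value z (f' (- z) x)) ->
  forall v x, f v x = f' v x.
Proof.
move=> ff; have E : hcomp (reshift _ z) f = hcomp (reshift _ z) f'.
  apply: (cofree_mor_eq (orthant0_shift z)) => x /=.
  apply/eqP; rewrite -subr_eq0; apply/eqP.
  apply: (@vunit_map_inj K _ true); first exact: implybT.
  by rewrite linearB; apply/eqP; rewrite subr_eq0; apply/eqP/ff.
by move=> v x; exact: (congr1 (fun h : mor V (interval K _) => h v x) E).
Qed.

End Orthants.

(** * The cohomology of the dual of a resolution *)

Section Duality.
Context (K : fieldType) (N : nat) (M : functor K N) (G : complex K N).
Hypothesis M_fg : finitely_generated M.
Hypothesis M_ev : eventually_vanishes M.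
Hypothesis resG : free_resolution G M.

Local Notation X k := (orthant_module K N k).
Local Notation Y k := (hinge_module K N k).

Lemma resolution_projective i : projective (G i).
Proof. by have [fG _ _] := resG; apply: free_projective; have [] := fG i. Qed.

Lemma hinge_exact k z j : (k < N)%N -> hom_exact G (shift (Y k) z) j.
Proof.
move=> kN; have [n kill] := axis_step_kills M_fg M_ev.
have [r rP] := periodic_retraction K (@hinge_convex N k)
  (axis_step_ge0 (Ordinal kN) n) (hinge_periodic (Ordinal kN) n z).
by apply: (hom_exact_translate resG) rP => v x; apply: kill.
Qed.

(** Cochains with coefficients in a cofree module are functionals on one component of
    [G], and the dual of an exact sequence of vector spaces is exact. *)
Lemma orthant0_exact z j : j != 0 -> hom_exact G (shift (X 0) z) j.
Proof.
have [fG G_neg [_ [_ _ exG]]] := resG.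
case: (ltgtP j 0) => // [jlt0|jgt0] _; first exact/hom_exact_zero_term/G_neg.
move=> i k h h' f cf.
have [||m mP] := factor_functional (f := bd G h (- z)) (l := top_value K z \o f (- z)).
- by have [] := fG i.
- by move=> x /(exG _ _ _ h' h _ _ jgt0) [y <-]; rewrite /= cf linear0.
have [g gP] := orthant0_mor m; exists g.
by apply: (orthant0_mor_eq (f' := hcomp g (bd G h))) => x; rewrite /= gP -mP.
Qed.

(** Dimension shifting along the acyclic hinge modules. *)
Lemma orthant_exact k z j : (k <= N)%N -> j != k%:Z -> hom_exact G (shift (X k) z) j.
Proof.
elim: k j => [|k IH] j kN jk; first exact: orthant0_exact.
have hj : j = j - 1 + 1 by rewrite subrK.
have [a [b /(shift_short_exact z) abE]] := hinge_short_exact K kN.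
apply: (hom_exact_sub resolution_projective abE hj); first exact: hinge_exact.
by apply: IH; [exact: ltnW|lia].
Qed.

Section Links.
Context (eps : mor (G 0) M).
Hypothesis eps_surj : forall z (x : M z), exists y, eps z y = x.
Hypothesis ker_eps : forall z (x : G 0 z),
  eps z x = 0 <-> exists y, bd G (erefl : 1 = 0 + 1 :> int) z y = x.
Context (a : forall k, mor (X k.+1) (Y k)) (b : forall k, mor (Y k) (X k)).
Hypothesis abE : forall k, (k < N)%N -> short_exact (a k) (b k).

Fact degS k : (k.+1)%:Z = k%:Z + 1.
Proof. lia. Qed.

(** The [k]-fold composite of connecting homomorphisms, from the dual of [M] to the
    degree [k] cohomology with coefficients in the [k]-th orthant. *)
Fixpoint links z k : mor (G k%:Z) (shift (X k) z) -> pointwise_dual M z -> Prop :=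
  match k with
  | 0 => fun f m => forall y, top_value K z (f (- z) y) = m (eps (- z) y)
  | k'.+1 => fun f m => exists2 f0, links f0 m &
      connects (shift_mor (a k') z) (shift_mor (b k') z) (degS k') f0 f
  end.

Lemma links_linear z k c f f' m m' :
  @links z k f m -> @links z k f' m' -> links (c *: f + f') (c *: m + m').
Proof.
elim: k f f' => [|k IH] f f' /=; first by move=> fm fm' y; rewrite linearP fm fm'.
move=> [f0 f0m [g gf gf']] [f1 f1m [g' g'f g'f']].
exists (c *: f0 + f1); first exact: IH.
exists (c *: g + g') => v x; rewrite /= linearP /=; last by rewrite -gf' -g'f'.
by rewrite -gf -g'f.
Qed.

Lemma links_natural z w (h : gle z w) k f m : @links z k f m ->
  @links w k (hcomp (shift_map (X k) h) f) (smap (pointwise_dual M) h m).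
Proof.
elim: k f => [|k IH] f /=.
  move=> fm y; rewrite -app_natural -fm app_natural.
  refine (@vunit_map_square K (box (orthant 0) (z - w)) _ _ true (f (- w) y) _).
  by rewrite !subrr.
move=> [f0 f0m [g gf gf']].
exists (hcomp (shift_map (X k) h) f0); first exact: IH.
exists (hcomp (shift_map (Y k) h) g) => v x.
  refine (etrans (app_natural (b k) (gle_addr v h) (g v x)) _).
  exact: (congr1 (smap (X k) (gle_addr v h)) (gf v x)).
refine (etrans _ (esym (app_natural (a k) (gle_addr v h) (f v x)))).
exact: (congr1 (smap (Y k) (gle_addr v h)) (gf' v x)).
Qed.

Lemma links_cocycle z k f m : (k <= N)%N -> @links z k f m ->
  forall l (h : l = k%:Z + 1), cocycle h f.
Proof.
case: k f => [|k] f kN /=; last first.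
  by move=> [f0 _ f0f] l h; apply: connects_cocycle_sub f0f; apply/shift_short_exact/abE.
move=> fm l h; have l1 : l = 1 := h; move: h; rewrite l1 => h v x.
rewrite (Prop_irrelevance h erefl).
apply: (orthant0_mor_eq (f := hcomp f (bd G erefl)) (f' := 0)).
move=> y /=; rewrite fm linear0 [eps _ _](_ : _ = 0) ?linear0 //.
by apply/ker_eps; exists y.
Qed.

Lemma links_exists z k m : (k <= N)%N -> exists f, @links z k f m.
Proof.
elim: k => [_|k IH kN] /=; first exact: (orthant0_mor (m \o eps (- z))).
have [f0 f0m] := IH (ltnW kN).
have [f f0f] := connects_exists resolution_projective (shift_short_exact z (abE kN))
  (links_cocycle (ltnW kN) f0m (degS k)).
by exists f, f0.
Qed.

(** A connecting homomorphism is surjective, because the middle term has no cohomology.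
    In degree zero, a cocycle factors through the cokernel of the differential, which
    is [M]. *)
Lemma links_exists_dual z k f : (k <= N)%N ->
  (forall l (h : l = k%:Z + 1), cocycle h f) -> exists m, @links z k f m.
Proof.
elim: k f => [|k IH] f kN cf /=.
  have /choice[s sP] := @eps_surj (- z).
  have f_eps y y' : eps (- z) y = eps (- z) y' -> f (- z) y = f (- z) y'.
    move=> E; apply/eqP; rewrite -subr_eq0 -linearB; apply/eqP.
    have [|t <-] := (ker_eps (y - y')).1; first by rewrite linearB E subrr.
    exact: cf.
  have [m mP] : exists m : {linear M (- z) -> K^o},
      m =1 fun x => top_value K z (f (- z) (s x)).
    apply: exists_linear => c x y; rewrite -linearP -linearP; congr (top_value K z _).
    by apply: f_eps; rewrite linearP !sP.
  by exists m => y; rewrite mP; congr (top_value K z _); apply: f_eps; rewrite sP.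
have [f0 f0f] := connects_exists_quot (shift_mor (a k) z) (shift_mor (b k) z)
  (degS k) (@hinge_exact k z _ kN) (cf _ erefl).
have [m f0m] : exists m, @links z k f0 m.
  apply: IH (ltnW kN) _ => l h.
  have El : l = k.+1%:Z by rewrite h degS.
  move: h; rewrite El => h; rewrite (Prop_irrelevance h (degS k)).
  by refine (connects_cocycle (shift_short_exact z (abE kN)) f0f).
by exists m, f0.
Qed.

(** A connecting homomorphism maps coboundaries to coboundaries. *)
Lemma links0_coboundary z k f : (k <= N)%N -> @links z k f 0 ->
  forall i (h : k%:Z = i + 1), coboundary h f.
Proof.
elim: k f => [|k IH] f kN /=.
  move=> f0 i h; exists 0 => v x; apply: (orthant0_mor_eq (f' := 0)) => y.
  by rewrite f0 linear0.
move=> [f0 f00 f0f] i h.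
have Ei : i = k%:Z by move: (h); rewrite degS => /addIr.
move: h; rewrite Ei => h; rewrite (Prop_irrelevance h (degS k)).
have hk : k%:Z = k%:Z - 1 + 1 by rewrite subrK.
apply: (connects_coboundary resolution_projective (shift_short_exact z (abE kN))
  (h' := hk) f0f).
exact: (IH _ (ltnW kN) f00 _ hk).
Qed.

(** A connecting homomorphism reflects coboundaries, because the middle term has no
    cohomology, and in degree zero the only coboundary is zero. *)
Lemma coboundary_links0 z k f m i (h : k%:Z = i + 1) : (k <= N)%N ->
  @links z k f m -> coboundary h f -> m = 0.
Proof.
elim: k f i h => [|k IH] f i h kN /=.
  move=> fm [g gP]; apply: linearP_eq => x; have [y <-] := eps_surj x.
  rewrite -fm gP [bd G h _ _](_ : _ = 0) ?linear0 //.
  apply/eqP; apply: contraT => n0; have [_ G_neg _] := resG.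
  by case: (G_neg i); [lia|exists (- z), (bd G h (- z) y)].
move=> [f0 f0m f0f] cf.
have Ei : i = k%:Z by move: (h); rewrite degS => /addIr.
move: h cf; rewrite Ei => h; rewrite (Prop_irrelevance h (degS k)) => cf.
have hk : k%:Z = k%:Z - 1 + 1 by rewrite subrK.
apply: (IH f0 _ hk (ltnW kN) f0m).
apply: (connects_coboundary_quot (shift_short_exact z (abE kN)) _ _ f0f cf).
exact: hinge_exact.
Qed.

(** Each connecting homomorphism is bijective up to coboundaries, and so is their
    composite.  In degree [N] all cochains are cocycles, so that the composite is
    inverted on the whole space of cochains. *)
Lemma links_function : (forall j : int, N%:Z < j -> ~ nonzero_functor (G j)) ->
  exists E : forall z, {linear mor (G N%:Z) (shift (X N) z) -> pointwise_dual M z},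
  [/\ forall z w (h : gle z w) f,
         E w (hcomp (shift_map (X N) h) f) = smap (pointwise_dual M) h (E z f),
      forall z m, exists f, E z f = m &
      forall z f i (h : N%:Z = i + 1), E z f = 0 <-> coboundary h f].
Proof.
move=> G_top.
have cf z (f : mor (G N%:Z) (shift (X N) z)) l (h : l = N%:Z + 1) : cocycle h f.
  move=> v x; have [->|x0] := eqVneq x 0; first by rewrite !linear0.
  by case: (G_top l); [lia|exists v, x].
pose E z f := sval (cid (links_exists_dual (leqnn N) (@cf z f))).
have EP z f : links f (E z f) := svalP (cid (links_exists_dual (leqnn N) (@cf z f))).
have E_unique z f m : @links z N f m -> E z f = m.
  move=> fm; apply/eqP; rewrite -subr_eq0; apply/eqP.
  have hN : N%:Z = N%:Z - 1 + 1 by rewrite subrK.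
  apply: (@coboundary_links0 z N 0 _ _ hN) => //.
    have := links_linear (-1) fm (EP z f).
    by rewrite !scaleN1r addNr addrC.
  by exists 0 => v x.
have E_linear z : linear (E z).
  by move=> c f f'; apply: E_unique; apply: links_linear; exact: EP.
pose El z := sval (cid (exists_linear (@E_linear z))).
have ElE z : El z =1 E z := svalP (cid (exists_linear (@E_linear z))).
exists El; split=> [z w h f|z m|z f i h]; rewrite ?ElE.
- by apply: E_unique; apply: links_natural; exact: EP.
- by have [f fm] := links_exists m (leqnn N); exists f; rewrite ElE; apply: E_unique.
split=> [E0|]; last exact: coboundary_links0 (EP z f).
by apply: links0_coboundary => //; rewrite -E0; exact: EP.
Qed.

End Links.
End Duality.

Lemma hinge_short_exact_family (K : fieldType) (N : nat) :
  exists (a : forall k, mor (orthant_module K N k.+1) (hinge_module K N k))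
         (b : forall k, mor (hinge_module K N k) (orthant_module K N k)),
  forall k, (k < N)%N -> short_exact (a k) (b k).
Proof.
have hinge k : exists p : mor (orthant_module K N k.+1) (hinge_module K N k) *
                          mor (hinge_module K N k) (orthant_module K N k),
    (k < N)%N -> short_exact p.1 p.2.
  have [kN|_] := ltnP k N; last by exists (0, 0).
  by have [a [b abE]] := hinge_short_exact K kN; exists (a, b).
exists (fun k => (sval (cid (hinge k))).1), (fun k => (sval (cid (hinge k))).2).
exact: (fun k => svalP (cid (hinge k))).
Qed.

(** The last orthant module is the free module that defines the global dual. *)
Lemma top_duality (K : fieldType) (N : nat) (M : functor K N) (G : complex K N) :
  finitely_generated M -> eventually_vanishes M -> free_resolution G M ->
  (forall j : int, N%:Z < j -> ~ nonzero_functor (G j)) ->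
  exists E : forall z, {linear global_dual (G N%:Z) z -> pointwise_dual M z},
  [/\ forall z w (h : gle z w) f,
         E w (smap (global_dual (G N%:Z)) h f) = smap (pointwise_dual M) h (E z f),
      forall z m, exists f, E z f = m &
      forall z f i (h : N%:Z = i + 1), E z f = 0 <-> coboundary h f].
Proof.
move=> fg ev resG G_top.
have [_ _ [eps [eps1 ker_eps _]]] := resG.
have [a [b abE]] := hinge_short_exact_family K N.
have := links_function fg ev resG eps1 ker_eps abE G_top.
by rewrite orthant_module_free.
Qed.

(** The composite of the connecting homomorphisms is injective on the dual of [M], and
    it takes values in a quotient of [Hom(G_N, F(1)<z>)]. *)
Lemma resolution_top_nonzero (K : fieldType) (N : nat) (M : functor K N) (G : complex K N) :
  persistence_module M -> finitely_generated M -> eventually_vanishes M ->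
  free_resolution G M -> nonzero_functor M -> nonzero_functor (G N%:Z).
Proof.
move=> pm fg ev resG [w [x x0]]; apply: contrapT => G_N.
have [_ _ [eps [eps1 ker_eps _]]] := resG.
have [a [b abE]] := hinge_short_exact_family K N.
have [m mx] : exists m : pointwise_dual M (- w), m != 0.
  have [y y0] : nonzero (M (- - w)) by rewrite opprK; exists x.
  have [m mx] := nonzero_functional (pm _) y0; exists m.
  by apply/eqP => m0; move: mx; rewrite m0 => /esym/eqP; rewrite oner_eq0.
have [f fm] := links_exists resG ker_eps abE m (leqnn N).
have hN : N%:Z = N%:Z - 1 + 1 by rewrite subrK.
case/eqP: mx; apply: (coboundary_links0 fg ev resG eps1 abE (h := hN) (leqnn N) fm).
refine (@hom_exact_zero_term _ _ _ _ _ G_N _ _ hN erefl f _).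
by refine (links_cocycle ker_eps abE (leqnn N) fm _).
Qed.

(** * Simple modules and minimality *)

Section Simple.
Context (K : fieldType) (N : nat).
Implicit Types (X P : functor K N).

Lemma gle_anti (u v : grade N) : gle u v -> gle v u -> u = v.
Proof.
move=> /forallP uv /forallP vu; apply/rowP => i; apply: le_anti.
by rewrite uv vu.
Qed.

Fact simple_convex (w : grade N) : convex_region (pred1 w).
Proof.
by move=> u v t uv vt /eqP uw /eqP tw; subst u t; rewrite /= (gle_anti vt uv).
Qed.
Definition simple_module w : functor K N := interval K (@simple_convex w).

Lemma simple_module0 w v (x : simple_module w v) : v != w -> x = 0.
Proof. by move=> vw; apply: vunit_false. Qed.

(** The quotient of a cyclic interval module by everything above its generator. *)
Lemma simple_quotient X A (cA : convex_region A) w : X = interval K cA ->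
  A w -> (forall v, A v -> gle w v) ->
  exists p : mor X (simple_module w),
    (forall x, p w x = 0 -> x = 0) /\ (forall v y, exists x, p v x = y).
Proof.
move=> -> Aw wA.
have As v t : gle v t -> A v -> pred1 w t -> A t = pred1 w v.
  by move=> vt /wA wv /eqP tw; subst t; rewrite Aw (gle_anti vt wv) /= eqxx.
exists (interval_map K cA (@simple_convex w) As); split=> [x|v y] /=.
  by apply: vunit_map_inj; rewrite /= eqxx implybT.
exists (vunit_map K (v == w) (A v) y); rewrite vunit_map_comp; first exact: vunit_map_id.
by case: eqP => // ->; rewrite Aw.
Qed.

Lemma free1_simple_quotient w :
  exists p : mor (free1 K w) (simple_module w),
    (forall x, p w x = 0 -> x = 0) /\ (forall v y, exists x, p v x = y).
Proof.
have cw : convex_region (gle w) by move=> u v t uv _ wu _; apply: gle_trans wu uv.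
apply: (@simple_quotient _ _ cw); [exact: functor_eq|exact: gle_refl|by []].
Qed.

(** One basis element goes to the generator of the simple module, and the others to
    zero. *)
Lemma free_nonzero_simple P : free_module P -> nonzero_functor P ->
  exists w (f : mor P (simple_module w)) v x, f v x != 0.
Proof.
move=> /free_module_basis [I [g [e [ex un]]]] [z [x x0]].
have [i0] : exists i0 : I, True.
  apply: contrapT => noI; have E : hid P = 0.
    by apply: un => i; case: noI; exists i.
  case/eqP: x0; exact: (congr1 (fun f : mor P P => f z x) E).
have [f fP] := ex (simple_module (g i0)) (fun i =>
  if i == i0 then vunit_map K true (g i == g i0) 1 else 0).
exists (g i0), f, (g i0), (e i0); rewrite fP eqxx; apply/eqP.
move/(congr1 (vunit_map K (g i0 == g i0) true)).
rewrite vunit_map_scalar ?eqxx // linear0 /vunit_map /= => /eqP.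
by rewrite oner_eq0.
Qed.

(** Between the free module at [w] and the simple module at [w]: the first [k]
    coordinates are fixed. *)
Definition corner (w : grade N) (k : nat) (i : 'I_N) : pred int :=
  fun x => if (i < k)%N then x == w ord0 i else w ord0 i <= x.

End Simple.

Fact corner_convex (N : nat) (w : grade N) k : convex_region (box (corner w k)).
Proof.
by apply: box_convex => i x y z; rewrite /corner; case: ifP => _; lia.
Qed.

Section Corners.
Context (K : fieldType) (N : nat) (M : functor K N) (G : complex K N).
Hypothesis M_fg : finitely_generated M.
Hypothesis M_ev : eventually_vanishes M.
Hypothesis resG : free_resolution G M.

(** The cohomology of each quotient is squeezed between that of the previous module in
    degree [j] and that of a translate of it in degree [j + 1]. *)
Lemma corner_exact k w j : (k <= N)%N -> N%:Z < j ->
  hom_exact G (interval K (@corner_convex N w k)) j.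
Proof.
elim: k w j => [|k IH] w j kN jN.
  have -> : interval K (@corner_convex N w 0) = shift (orthant_module K N N) (gone N - w).
    rewrite shift_interval; apply: interval_eq => v.
    apply: eq_forallb => i; rewrite /corner /orthant ltn_ord !mxE.
    by rewrite -addrA lerDl addrC subr_ge0.
  by apply: (orthant_exact M_fg M_ev resG) => //; lia.
pose i := Ordinal kN.
have [|x|x y|a [b abE]] := @box_short_exact K N (corner (w + axis_step i 1) k)
    (corner w k) (corner w k.+1) (@corner_convex N _ k) (@corner_convex N w k)
    (@corner_convex N w k.+1) i.
- move=> l li; have /negPf lk : l != k :> nat by [].
  have lkS : (l < k.+1)%N = (l < k)%N by rewrite ltnS leq_eqVlt lk.
  by split=> x; rewrite /corner ?lkS // !mxE (negPf li) addr0.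
- rewrite /corner /= ltnn ltnSn !mxE eqxx.
  move: (w ord0 i) => c; lia.
- rewrite /corner /= ltnn ltnSn !mxE eqxx.
  move: (w ord0 i) => c; lia.
apply: (hom_exact_quot (resolution_projective resG) abE (erefl (j + 1))).
  by apply: IH => //; exact: ltnW.
by apply: IH; [exact: ltnW|lia].
Qed.

Lemma simple_exact w j : N%:Z < j -> hom_exact G (simple_module K w) j.
Proof.
move=> jN; have -> : simple_module K w = interval K (@corner_convex N w N).
  apply: interval_eq => v; apply/eqP/forallP => [-> i|vw].
    by rewrite /corner ltn_ord.
  by apply/rowP => i; have := vw i; rewrite /corner ltn_ord => /eqP.
exact: corner_exact.
Qed.

End Corners.

(** * Splitting off homological balls *)

Section Kernels.
Context (K : fieldType).

Section KernelSpace.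
Context (V W : lmodType K) (f : {linear V -> W}).

Definition in_kernel : {pred V} := fun x => f x == 0.
Fact in_kernel_submod : submod_closed in_kernel.
Proof.
split=> [|a x y]; rewrite /in_kernel !unfold_in ?linear0 // linearP.
by move=> /eqP -> /eqP ->; rewrite scaler0 addr0.
Qed.
HB.instance Definition _ := GRing.isSubmodClosed.Build K V in_kernel in_kernel_submod.

Record kernel_space := KernelSpace { kernel_val :> V; _ : kernel_val \in in_kernel }.
HB.instance Definition _ := [isSub for kernel_val].
HB.instance Definition _ := [Choice of kernel_space by <:].
HB.instance Definition _ := [SubChoice_isSubLmodule of kernel_space by <:].

Lemma kernel_valP (x : kernel_space) : f (kernel_val x) = 0.
Proof. by case: x => x /= /eqP. Qed.

Lemma exists_kernel_val (x : V) : f x = 0 -> exists y : kernel_space, kernel_val y = x.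
Proof. by move=> /eqP fx; exists (KernelSpace fx). Qed.
End KernelSpace.

Lemma kernel_space_map (V W V' W' : lmodType K) (f : {linear V -> W})
    (f' : {linear V' -> W'}) (g : {linear V -> V'}) :
  (forall x, f x = 0 -> f' (g x) = 0) ->
  exists h : {linear kernel_space f -> kernel_space f'},
    forall x, kernel_val (h x) = g (kernel_val x).
Proof.
move=> fg.
have /choice[h0 hP] (x : kernel_space f) :
    exists y : kernel_space f', kernel_val y = g (kernel_val x).
  exact: exists_kernel_val (fg _ (kernel_valP x)).
have [h hE] : exists h : {linear kernel_space f -> kernel_space f'},
    h =1 h0.
  by apply: exists_linear => a x y; apply: val_inj; rewrite linearP /= !hP linearP.
by exists h => x; rewrite hE.
Qed.

End Kernels.

Section Splitting.
Context (K : fieldType) (N : nat).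
Implicit Types (L M : functor K N) (C D : complex K N).

(** The complement is the kernel of the retraction.  Its structure maps and
    differentials are restrictions, so the identities between them hold because they
    hold in [C]. *)
Lemma retract_direct_summand D C (i : forall n, mor (D n) (C n))
    (r : forall n, mor (C n) (D n)) :
  (forall m n (h : m = n + 1) z x, i n z (bd D h z x) = bd C h z (i m z x)) ->
  (forall m n (h : m = n + 1) z x, r n z (bd C h z x) = bd D h z (r m z x)) ->
  (forall n z x, r n z (i n z x) = x) ->
  direct_summand D C.
Proof.
move=> i_bd r_bd ri.
pose sm n z w (h : gle z w) : {linear kernel_space (r n z) -> kernel_space (r n w)} :=
  sval (cid (kernel_space_map (f := r n z) (f' := r n w) (g := smap (C n) h)
    (fun x rx => etrans (app_natural (r n) h x) (etrans (congr1 _ rx) (linear0 _))))).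
have smE n z w (h : gle z w) x : kernel_val (sm n z w h x) = smap (C n) h (kernel_val x).
  by rewrite /sm; case: cid.
have sm_id n z (h : gle z z) x : sm n z z h x = x.
  by apply: val_inj; rewrite /= smE smap_id.
have sm_comp n u v w (h : gle u v) (h' : gle v w) (h'' : gle u w) x :
    sm n v w h' (sm n u v h x) = sm n u w h'' x.
  by apply: val_inj; rewrite /= !smE (smap_comp _ _ h'').
pose E n : functor K N := @Functor K N (fun z => kernel_space (r n z)) (sm n)
  (sm_id n) (sm_comp n).
pose bm m n (h : m = n + 1) z : {linear E m z -> E n z} :=
  sval (cid (kernel_space_map (f := r m z) (f' := r n z) (g := bd C h z)
    (fun x rx => etrans (r_bd m n h z x) (etrans (congr1 _ rx) (linear0 _))))).
have bmE m n (h : m = n + 1) z x : kernel_val (bm m n h z x) = bd C h z (kernel_val x).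
  by rewrite /bm; case: cid.
have bm_nat m n (h : m = n + 1) z w (zw : gle z w) x :
    bm m n h w (smap (E m) zw x) = smap (E n) zw (bm m n h z x).
  by apply: val_inj; rewrite /= bmE !smE bmE app_natural.
pose bE m n h : mor (E m) (E n) := Mor (bm_nat m n h).
have bE_bE l m n (h : l = m + 1) (h' : m = n + 1) z x :
    bE m n h' z (bE l m h z x) = 0.
  by apply: val_inj; rewrite /= !bmE bd_bd.
exists (@Complex K N E bE bE_bE).
have c0 n z (x : C n z) : r n z (x - i n z (r n z x)) = 0.
  by rewrite linearB ri subrr.
pose c n z (x : C n z) : E n z := sval (cid (exists_kernel_val (c0 n z x))).
have cE n z (x : C n z) : kernel_val (c n z x) = x - i n z (r n z x).
  by rewrite /c; case: cid.
have flin n z : linear (fun x : C n z => (r n z x, c n z x) : (D n z * E n z)%type).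
  move=> a x y; congr pair; rewrite ?linearP //; apply: val_inj.
  by rewrite linearP /= !cE !linearP /= scalerBr scalerN addrACA.
pose fl n z := sval (cid (exists_linear (flin n z))).
have flE n z x : fl n z x = (r n z x, c n z x) by rewrite /fl; case: cid.
have fnat n z w (h : gle z w) x :
    fl n w (smap (C n) h x) = smap (biprod (D n) (E n)) h (fl n z x).
  rewrite !flE /= /pair_map /= app_natural; congr pair; apply: val_inj.
  by rewrite /= smE !cE linearB !app_natural.
have glin n z : linear (fun x : (D n z * E n z)%type => i n z x.1 + kernel_val x.2).
  by move=> a x y; rewrite /= !linearP /= scalerDr addrACA.
pose gl n z := sval (cid (exists_linear (glin n z))).
have glE n z x : gl n z x = i n z x.1 + kernel_val x.2 by rewrite /gl; case: cid.
have gnat n z w (h : gle z w) x :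
    gl n w (smap (biprod (D n) (E n)) h x) = smap (C n) h (gl n z x).
  by rewrite !glE linearD /= smE app_natural.
exists (fun n => @Mor K N (C n) (biprod (D n) (E n)) (fl n) (fnat n)).
exists (fun n => @Mor K N (biprod (D n) (E n)) (C n) (gl n) (gnat n)).
split=> [m n h|n].
  apply: morP => z x; rewrite /= !flE /pair_map /= r_bd; congr pair; apply: val_inj.
  by rewrite /= bmE !cE linearB /= r_bd i_bd.
split; apply: morP => z x; rewrite /= ?glE ?flE /= ?cE; first by rewrite addrC subrK.
case: x => x e; rewrite /= linearD /= ri kernel_valP addr0; congr pair.
by apply: val_inj; rewrite /= cE linearD /= ri kernel_valP addr0 addrC addKr.
Qed.

(** A ball splits off as soon as its generator and its dual are given: [x] holds the
    images of the two generators and [l] the coordinates along them; only the values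
    in the degrees [n + 1] and [n] matter. *)
Lemma ball_summand C w n (x : forall i, C i w) (l : forall i, mor (C i) (free1 K w)) :
  (forall i j (h : i = j + 1), in_ball n i ->
     bd C h w (x i) = if in_ball n j then x j else 0) ->
  (forall i j (h : i = j + 1), in_ball n j -> forall v y,
     l j v (bd C h v y) = if in_ball n i then l i v y else 0) ->
  (forall i, in_ball n i -> l i w (x i) = free1_unit K w) ->
  direct_summand (ball K w n) C.
Proof.
move=> x_bd l_bd lx.
pose f i := sval (cid (free1_mor (x i))).
have fE i : f i w (free1_unit K w) = x i := svalP (cid (free1_mor (x i))).
pose inj b i : mor (fzero_or K b w) (C i) :=
  match b with true => f i | false => mor0 _ _ end.
pose prj b i : mor (C i) (fzero_or K b w) :=
  match b with true => l i | false => mor0 _ _ end.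
apply: (@retract_direct_summand (ball K w n) C
  (fun i => inj (in_ball n i) i) (fun i => prj (in_ball n i) i)).
- move=> i j h z y; move: (x_bd i j h) y; rewrite /=.
  case: (in_ball n i) => [/(_ isT) E|_] y; last first.
    by rewrite [y]thinmx0 !linear0.
  have Emor : hcomp (inj (in_ball n j) j) (fzero_or_map K true (in_ball n j) w) =
      hcomp (bd C h) (f i).
    apply: free1_mor_eq; rewrite /= fE E.
    by case: (in_ball n j); rewrite //= fE.
  exact: (congr1 (fun m : mor (free1 K w) (C j) => m z y) Emor).
- move=> i j h z y; move: (l_bd i j h); rewrite /=.
  case: (in_ball n j) => [/(_ isT) ->|_] /=.
    by case: (in_ball n i); rewrite //= linear0.
  by case: (in_ball n i).
move=> i z y; move: (lx i) y; rewrite /=.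
case: (in_ball n i) => [/(_ isT) E|_] y; last by rewrite [RHS]thinmx0.
have Emor : hcomp (l i) (f i) = hid (free1 K w) by apply: free1_mor_eq; rewrite /= fE.
exact: (congr1 (fun m : mor (free1 K w) (free1 K w) => m z y) Emor).
Qed.

(** The maps to simple modules have the radical as their common kernel, so this says
    that the differential takes values in the radical. *)
Definition radical_differential C : Prop :=
  forall i j (h : i = j + 1) w (f : mor (C j) (simple_module K w)), cocycle h f.

(** If [f (d x) <> 0] for some [x] in degree [n + 1], then [f] lifts to a map
    [l : C_n -> F(w)] with [l (d x)] a generator, and the ball with generators [x] and
    [d x] and coordinates [l d] and [l] splits off. *)
Lemma minimal_radical C : (forall i, projective (C i)) ->
  ~ (exists z n, direct_summand (ball K z n) C) -> radical_differential C.
Proof.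
move=> projC noball i n h w f z x.
have [zw|] := eqVneq z w; last exact: simple_module0.
subst z; apply/eqP; apply: contraT => fx; case: noball; exists w, n.
have [p [p0 p1]] := free1_simple_quotient K w.
have [l0 l0P] := projC n _ _ p f (fun v y => p1 v (f v y)).
pose c : K := vunit_map K (gle w w) true (l0 w (bd C h w x)).
have l0x : l0 w (bd C h w x) = c *: free1_unit K w by exact: vunit_scalar.
have c0 : c != 0.
  by apply: contra_neq fx => c0; rewrite -l0P l0x c0 scale0r linear0.
pose l1 := c^-1 *: l0.
have l1x : l1 w (bd C h w x) = free1_unit K w.
  by rewrite /= l0x scalerA mulVf // scale1r.
(* The generators and the coordinates, transported to an arbitrary degree. *)
pose xx k : C k w :=
  match pselect (i = k) with
  | left e => eq_rect i (fun k => C k w) x k e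
  | right _ =>
    match pselect (n = k) with
    | left e => eq_rect n (fun k => C k w) (bd C h w x) k e
    | right _ => 0
    end
  end.
have xxi : xx i = x.
  by rewrite /xx; case: pselect => // e; rewrite (Prop_irrelevance e erefl).
have xxn : xx n = bd C h w x.
  rewrite /xx; case: pselect => [e|_]; first by exfalso; lia.
  by case: pselect => // e; rewrite (Prop_irrelevance e erefl).
pose ll k : mor (C k) (free1 K w) :=
  match pselect (i = k) with
  | left e => eq_rect i (fun k => mor (C k) (free1 K w)) (hcomp l1 (bd C h)) k e
  | right _ =>
    match pselect (n = k) with
    | left e => eq_rect n (fun k => mor (C k) (free1 K w)) l1 k e
    | right _ => 0
    end
  end.
have lli : ll i = hcomp l1 (bd C h).
  by rewrite /ll; case: pselect => // e; rewrite (Prop_irrelevance e erefl).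
have lln : ll n = l1.
  rewrite /ll; case: pselect => [e|_]; first by exfalso; lia.
  by case: pselect => // e; rewrite (Prop_irrelevance e erefl).
have ball_i : in_ball n i by rewrite /in_ball h eqxx.
have ball_n : in_ball n n by rewrite /in_ball eqxx orbT.
have ballP k : in_ball n k -> k = i \/ k = n.
  by rewrite /in_ball h => /orP[] /eqP; [left|right].
apply: (@ball_summand C w n xx ll).
- move=> k m hk /ballP[Ek|Ek].
    have Em : m = n by apply: (@addIr _ 1); rewrite -hk Ek.
    subst m; rewrite ball_n xxn; move: hk; rewrite Ek => hk.
    by rewrite xxi (Prop_irrelevance hk h).
  move: hk; rewrite Ek => hk; rewrite xxn bd_bd ifN // /in_ball; lia.
- move=> k m hk /ballP[Em|Em] v y.
    move: hk y; rewrite Em => hk y; rewrite lli /= bd_bd linear0 scaler0 ifN // /in_ball; lia.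
  move: hk y; rewrite Em => hk; have Ek : k = i by rewrite hk h.
  move: hk; rewrite Ek => hk y; rewrite lln ball_i lli /=.
  by rewrite (Prop_irrelevance hk h).
by move=> k /ballP[->|->]; rewrite ?xxi ?lli ?xxn ?lln.
Qed.

(** The differential of a split ball is an identity, which survives in the simple
    quotient of its target. *)
Lemma radical_minimal C : radical_differential C ->
  ~ exists z n, direct_summand (ball K z n) C.
Proof.
move=> radC [z [n [E [f [g [f_bd fgE]]]]]].
have [p [p0 _]] := free1_simple_quotient K z.
pose u b : fzero_or K b z z :=
  match b with true => free1_unit K z | false => 0 end.
pose q b : mor (fzero_or K b z) (free1 K z) :=
  match b with true => hid _ | false => mor0 _ _ end.
have fst_nat v w (h : gle v w) (y : biprod (ball K z n n) (E n) v) :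
    (smap (biprod (ball K z n n) (E n)) h y).1 = smap (ball K z n n) h y.1 by [].
pose fst_mor : mor (biprod (ball K z n n) (E n)) (ball K z n n) :=
  @Mor K N (biprod (ball K z n n) (E n)) (ball K z n n)
    (fun v => GRing.Linear.clone K _ _ _ fst _) fst_nat.
pose x := g (n + 1) z (u (in_ball n (n + 1)), 0).
have := radC _ _ (erefl (n + 1)) z (hcomp p (hcomp (q (in_ball n n)) (hcomp fst_mor (f n)))) z x.
rewrite /=.
have -> : f n z (bd C erefl z x) = bd (complex_sum (ball K z n) E) erefl z (f (n + 1) z x).
  exact: (congr1 (fun m : mor (C (n + 1)) _ => m z x) (f_bd _ _ (erefl (n + 1)))).
have [_ fg] := fgE (n + 1).
have -> : f (n + 1) z x = (u (in_ball n (n + 1)), 0).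
  exact: (congr1 (fun m : mor (biprod _ _) _ => m z _) fg).
have qu (b b' : bool) : b -> b' -> q b z (fzero_or_map K b' b z z (u b')) = free1_unit K z.
  by case: b => //; case: b'.
rewrite /= qu; [|by rewrite /in_ball eqxx orbT|by rewrite /in_ball eqxx].
by move=> /p0 /eqP; apply/negP; exact: free1_unit_neq0.
Qed.

End Splitting.

(** * Lengths and dual resolutions *)

Section Main.
Context (K : fieldType) (N : nat).
Implicit Types (M : functor K N) (G : complex K N).

Lemma clength_max G d : clength G = Some d -> is_max_degree G d.
Proof.
by rewrite /clength; case: pselect => // h [<-]; exact: svalP (cid h).
Qed.

Lemma max_clength G d : is_max_degree G d -> clength G = Some d.
Proof.
move=> [Gd d_max]; rewrite /clength; case: pselect => [h|[]]; last by exists d.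
case: (cid h) => e [Ge e_max] /=; congr Some; apply/eqP.
by rewrite eqn_leq d_max //= e_max.
Qed.

Lemma zero_above_length G d : clength G = Some d ->
  forall j : int, d%:Z < j -> ~ nonzero_functor (G j).
Proof.
move=> /clength_max [_ d_max] [e|e] de Gj; last by lia.
by have := d_max _ Gj; lia.
Qed.

(** The [j]-th term of a resolution with radical differential detects the [j]-th
    cohomology with simple coefficients, since all cochains are cocycles and only
    zero is a coboundary. *)
Lemma radical_resolution_zero M G j : finitely_generated M -> eventually_vanishes M ->
  free_resolution G M -> radical_differential G -> N%:Z < j -> ~ nonzero_functor (G j).
Proof.
move=> fg ev resG radG jN Gj; have [freeG _ _] := resG.
have [w [f [v [x /eqP fx]]]] := free_nonzero_simple (freeG j).2 Gj.
have hj : j = j - 1 + 1 by rewrite subrK.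
have exS : hom_exact G (simple_module K w) j by refine (@simple_exact K N M G fg ev resG w j jN).
have [g gf] := exS _ _ hj erefl f (radG _ _ erefl w f).
by apply: fx; rewrite gf; exact: (radG _ _ hj w g).
Qed.

(** Dualizing keeps the differential radical: a functional composed with the
    differential vanishes in the only degree that a simple module of the dual sees. *)
Lemma dual_radical G n : (forall i, finite_rank_free (G i)) ->
  radical_differential G -> radical_differential (cdual (cshift G n)).
Proof.
move=> finG radG i j h w f z x.
have [zw|] := eqVneq z w; last exact: simple_module0.
subst z; apply: dual_concentrated => [|v y|y]; [exact: finG|exact: simple_module0|].
pose A v := gle (gone N) (w + v).
have cA : convex_region A.
  by move=> u v t uv _ Au _; apply: gle_trans Au _; apply: gle_addl.
have [|||s [s0 _]] := @simple_quotient _ _ (shift (free1 K (gone N)) w) A cA (gone N - w).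
- exact: functor_eq.
- by rewrite /A addrC subrK gle_refl.
- by move=> v; rewrite /A addrC gle_dual.
by apply: s0; exact: (radG _ _ _ _ (hcomp s x)).
Qed.

Section Resolution.
Context (M : functor K N) (G : complex K N).
Hypothesis M_fg : finitely_generated M.
Hypothesis M_ev : eventually_vanishes M.
Hypothesis resG : free_resolution G M.

(** The homology of the dual complex in degree [j] is the cohomology of
    [Hom(G, F(1)<z>)] in degree [N - j]. *)
Lemma dual_resolution : clength G = Some N ->
  (forall i, persistence_module (cdual (cshift G N%:Z) i)) ->
  free_resolution (cdual (cshift G N%:Z)) (pointwise_dual M).
Proof.
move=> lG pD; have G_top := zero_above_length lG; have [freeG _ _] := resG.
have [E [E_nat E_surj E_ker]] := top_duality M_fg M_ev resG G_top.
split=> [i|i i0 [z [f f0]]|].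
- by split=> //; apply: dual_free_module (freeG _).2 (pD i).
- case/eqP: f0; apply: morP => v x.
  have [->|x0] := eqVneq x 0; first by rewrite !linear0.
  by case: (G_top (- i + N%:Z)); [lia|exists v, x].
exists (@Mor K N (cdual (cshift G N%:Z) 0) (pointwise_dual M) E E_nat).
split=> [z m|z f|i j k hij hjk z f j0].
- exact: E_surj.
- rewrite /= (E_ker z f _ (cshift_degree N%:Z (cdual_degree (erefl : 1 = 0 + 1 :> int)))).
  split=> [[g gP]|[g <-]]; first by exists g; apply: morP => v x; rewrite gP.
  by exists g.
split=> [f_cocycle|[g <-]]; last exact: bd_bd.
have exF : hom_exact G (shift (free1 K (gone N)) z) (- j + N%:Z).
  by rewrite -orthant_module_free; apply: (orthant_exact M_fg M_ev resG) => //; lia.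
have [|g gP] := exF _ _ (cshift_degree N%:Z (cdual_degree hij))
  (cshift_degree N%:Z (cdual_degree hjk)) f.
  by move=> v x; exact: (congr1 (fun m : mor _ _ => m v x) f_cocycle).
by exists g; apply: morP => v x; rewrite gP.
Qed.

End Resolution.

End Main.

Theorem corollary1p4 (K : fieldType) (N : nat) (M : functor K N)
    (M_pm : persistence_module M) (M_fg : finitely_generated M)
    (M_ev : eventually_vanishes M) :
  (nonzero_functor M ->
    (forall G : complex K N,
        free_resolution G M -> length_at_least N (clength G)) /\
    (forall G : complex K N,
        minimal_free_resolution G M -> clength G = Some N)) /\
  ((forall G : complex K N,
       free_resolution G M -> clength G = Some N ->
       (forall i, persistence_module (cdual (cshift G N%:Z) i)) ->
       free_resolution (cdual (cshift G N%:Z)) (pointwise_dual M)) /\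
   (forall G : complex K N,
       minimal_free_resolution G M -> clength G = Some N ->
       minimal_free_resolution (cdual (cshift G N%:Z)) (pointwise_dual M))).
Proof.
have radical G : minimal_free_resolution G M -> radical_differential G.
  move=> [resG [_ noball]]; apply: minimal_radical noball => i.
  exact: resolution_projective resG i.
split=> [M0|].
  have top G : free_resolution G M -> nonzero_functor (G N%:Z).
    by move=> resG; apply: resolution_top_nonzero resG M0.
  split=> G resG.
    rewrite /length_at_least; case lG : (clength G) => [d|//].
    have [_ d_max] := clength_max lG.
    exact/d_max/top.
  apply: max_clength; split; first exact: top resG.1.
  move=> e Ge; rewrite leqNgt; apply/negP => eN.
  by apply: (radical_resolution_zero M_fg M_ev resG.1 (radical _ resG)) Ge; lia.
split=> G resG lG; first exact: dual_resolution.
have [_ [finG _]] := resG.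
split; last split.
- apply: dual_resolution resG.1 lG _ => // i.
  exact/finite_rank_persistence/dual_finite_rank_free/finG.
- by move=> i; exact/dual_finite_rank_free/finG.
exact/radical_minimal/dual_radical/radical.
Qed.
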